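(* Let $k$ be a field of characteristic $0$, $R=k[x_1,\ldots,x_n]$, and let $I\subset R$ be a homogeneous Artinian ideal, with $f_2,\ldots,f_n$ and $J_1,\ldots,J_{n-1}$ defined for $\mathrm{gin}(I)$ as in the context. Then $\mathrm{gin}(I)$ is almost reverse lexicographic if and only if: (1) for every $0\le i\le n-3$, there exist generic linear forms $L_1,\ldots,L_i$ in $R$ such that $R/(I+(L_1,\ldots,L_i))$ has the strong Lefschetz property; and (2) for each $3\le i\le n-1$, whenever $\alpha=(\alpha_1,\ldots,\alpha_i)$ and $\beta=(\beta_1,\ldots,\beta_i)$ are elements of $J_i$ with $|\alpha|=|\beta|$ and $\alpha<\beta$, we have $f_{i+1}(\beta)\le f_{i+1}(\alpha)$.
   Context: Monomials of $R$ are ordered by the degree reverse lexicographic order with $x_1>\cdots>x_n$; $\mathrm{gin}(I)$ is the generic initial ideal of $I$ with respect to this order. A homogeneous ideal is Artinian if the quotient is finite-dimensional over $k$. A monomial ideal $J$ is almost reverse lexicographic if for every minimal generator $m$ of $J$ and every monomial $M$ with $\deg M=\deg m$ and $M>m$, we have $M\in J$. A standard graded Artinian algebra $A=\bigoplus_d A_d$ has the strong Lefschetz property if there is a linear form $L$ such that for all $d$ and $i$ the multiplication map $\times L^i:A_d\to A_{d+i}$ is injective or surjective. ''Generic linear forms'' means linear forms chosen from a suitable nonempty Zariski-open subset of the space of tuples of linear forms (for $i=0$ no forms are added). Define $f_1=\min\{t\mid x_1^t\in\mathrm{gin}(I)\}$ and for $2\le i\le n$, $f_i(\alpha_1,\ldots,\alpha_{i-1})=\min\{t\ge0\mid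 x_1^{\alpha_1}\cdots x_{i-1}^{\alpha_{i-1}}x_i^t\in\mathrm{gin}(I)\}$ (value $\infty$ if none). For $1\le i\le n-1$, $J_i=\{(\alpha_1,\ldots,\alpha_i)\in\mathbb{Z}_{\ge0}^i\mid \alpha_1<f_1,\ \alpha_j<f_j(\alpha_1,\ldots,\alpha_{j-1})\text{ for }2\le j\le i\}$. $|\alpha|=\sum_j\alpha_j$, and $\alpha<\beta$ means $x_1^{\alpha_1}\cdots x_i^{\alpha_i}<x_1^{\beta_1}\cdots x_i^{\beta_i}$ in the reverse lexicographic order. *)

(* Defs.v *)
From HB Require Import structures.
From mathcomp Require Import all_boot all_order all_algebra.
From mathcomp Require Import mpoly.
From Stdlib Require Import ClassicalEpsilon.
Set Implicit Arguments. Unset Strict Implicit. Unset Printing Implicit Defensive.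
Import GRing.Theory.
Local Open Scope ring_scope.

Section Defs.
Variables (k : fieldType) (n : nat).
Local Notation mon := 'X_{1..n}.
Local Notation poly := {mpoly k[n]}.

Definition is_ideal (I : poly -> Prop) : Prop :=
  [/\ I 0, (forall f g, I f -> I g -> I (f + g)) & (forall r f, I f -> I (r * f))].

Definition homogeneous_ideal (I : poly -> Prop) : Prop :=
  is_ideal I /\ forall (f : poly) (d : nat), I f -> I (pihomog mdeg d f).

(* Artinian: R/I is a finite-dimensional k-vector space, i.e. finitely many
   polynomials span R modulo I *)
Definition artinian (I : poly -> Prop) : Prop :=
  exists s : seq poly, forall p : poly,
    exists c : 'I_(size s) -> k, I (p - \sum_(j < size s) c j *: s`_j).

(* degree reverse lexicographic order, x_1 > ... > x_n (x_i = 'X_(i-1)):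
   a < b iff deg a < deg b, or the degrees agree and the last nonzero entry
   of a - b is positive *)
Definition revlex_lt (a b : mon) : bool :=
  (mdeg a < mdeg b)%N ||
  ((mdeg a == mdeg b) &&
   [exists j : 'I_n, (b j < a j)%N && [forall l : 'I_n, (j < l)%N ==> (a l == b l)]]).

Definition revlex_le (a b : mon) : bool := (a == b) || revlex_lt a b.

Definition lead_mon (f : poly) (m : mon) : bool :=
  (m \in msupp f) && all (fun m' => revlex_le m' m) (msupp f).

Definition lin_change (g : 'M[k]_n) (f : poly) : poly :=
  f \mPo [tuple \sum_(j < n) g i j *: 'X_j | i < n].

Definition init_ideal_change (I : poly -> Prop) (g : 'M[k]_n) (m : mon) : Prop :=
  exists f, I f /\ lead_mon (lin_change g f) m.

(* J is the generic initial ideal of I (revlex): there is a nonempty Zariski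
   open set D(P) of matrices, all invertible, on which in(g.I) = J *)
Definition is_gin (I : poly -> Prop) (J : pred mon) : Prop :=
  exists P : {mpoly k[n * n]}, P != 0 /\
    forall g : 'M[k]_n, P.@[fun j => mxvec g 0 j] != 0 ->
      g \in unitmx /\ forall m, J m <-> init_ideal_change I g m.

Definition min_gen (J : pred mon) (m : mon) : Prop :=
  J m /\ forall m' : mon, (m' <= m)%MM -> m' != m -> ~~ J m'.

Definition almost_revlex (J : pred mon) : Prop :=
  forall m, min_gen J m ->
    forall M : mon, mdeg M = mdeg m -> revlex_lt m M -> J M.

Definition ideal_add_forms (I : poly -> Prop) (Ls : seq poly) (f : poly) : Prop :=
  exists (h0 : poly) (hs : 'I_(size Ls) -> poly),
    I h0 /\ f = h0 + \sum_(j < size Ls) hs j * Ls`_j.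

(* R/K has the strong Lefschetz property (K homogeneous, A_d = R_d / K_d) *)
Definition SLP (K : poly -> Prop) : Prop :=
  exists L : poly, L \is 1.-homog /\
    forall d i : nat,
      (forall f : poly, f \is d.-homog -> K (L ^+ i * f) -> K f) \/
      (forall h : poly, h \is (d + i)%N.-homog ->
         exists f : poly, f \is d.-homog /\ K (h - L ^+ i * f)).

Definition lin_forms (r : nat) (c : 'M[k]_(r, n)) : seq poly :=
  [seq \sum_(l < n) c j l *: 'X_l | j <- enum 'I_r].

(* Q holds for generic r-tuples of linear forms: on a nonempty Zariski open
   set D(P) of coefficient matrices *)
Definition generically (r : nat) (Q : 'M[k]_(r, n) -> Prop) : Prop :=
  exists P : {mpoly k[r * n]}, P != 0 /\
    forall c : 'M[k]_(r, n), P.@[fun j => mxvec c 0 j] != 0 -> Q c.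

Definition xmon (s : seq nat) : mon := [multinom nth 0%N s j | j < n].

(* f_{|s|+1}(s) = min { t | x^s x_{|s|+1}^t in J }, None = infinity *)
Definition fexp (J : pred mon) (s : seq nat) : option nat :=
  match excluded_middle_informative (exists t, J (xmon (rcons s t))) with
  | left H => Some (@ex_minn (fun t => J (xmon (rcons s t))) H)
  | right _ => None
  end.

Definition olt (a : nat) (o : option nat) : bool :=
  if o is Some b then (a < b)%N else true.

Definition ole (o1 o2 : option nat) : bool :=
  match o1, o2 with
  | _, None => true
  | None, Some _ => false
  | Some a, Some b => (a <= b)%N
  end.

Definition inJ (J : pred mon) (i : nat) (s : seq nat) : Prop :=
  size s = i /\ forall j, (j < i)%N -> olt (nth 0%N s j) (fexp J (take j s)).

End Defs.

(* Main.v *)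
Require Import Defs.
From HB Require Import structures.
From mathcomp Require Import all_boot all_order all_algebra.
From mathcomp Require Import mpoly.
From mathcomp Require Import generic_quotient zify.
From Stdlib Require Import Classical ClassicalEpsilon.
Set Implicit Arguments. Unset Strict Implicit. Unset Printing Implicit Defensive.
Import GRing.Theory.
Local Open Scope ring_scope.

(* Order the variables as in revlex and write [u] for a monomial in x_0, ..., x_q.
   Since [G] is a monomial ideal, multiplication by x_q^i on the quotient of
   k[x_0, ..., x_q] by [G] is injective (surjective) in a given degree iff a purely
   combinatorial condition on the monomials holds; [monomial_slp] is the disjunction
   of the two.  Given that [G] is strongly stable, this condition for all q >= 2
   together with (2) is equivalent to [G] being almost reverse lexicographic, by
   comparing divisors of minimal generators.

   In generic coordinates the revlex order lets one read the injectivity and the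
   surjectivity of x_q^i modulo I + (x_l | l > q) off the initial ideal, and
   Lefschetz maps keep full rank on Zariski-open sets of linear forms; so (1) is
   equivalent to the combinatorial condition.

   Strong stability is proved infinitesimally: move the generic coordinates by the
   shear x_j -> x_j + t x_i and let h(t) be a family in the ideal whose image F(t)
   has leading monomial m for all t.  Then F' - x_i dF/dx_j is again the
   image of an element of the ideal, and in characteristic 0 its leading monomial is
   m x_i / x_j. *)

(** * The degree reverse lexicographic order *)

Section Revlex.
Variable n : nat.
Implicit Types (a b c u v w m : 'X_{1..n}) (q : nat) (G : pred 'X_{1..n}).

Definition vars_lt q u := forall l : 'I_n, (q <= l)%N -> u l = 0%N.

Definition upset G := forall u v, (u <= v)%MM -> G u -> G v.

Definition strongly_stable G := forall (i j : 'I_n) m,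
  (i < j)%N -> (0 < m j)%N -> G m -> G (m - U_(j) + U_(i))%MM.

Lemma revlex_ltP a b : mdeg a = mdeg b ->
  reflect (exists j : 'I_n, (b j < a j)%N /\ forall l : 'I_n, (j < l)%N -> a l = b l)
          (revlex_lt a b).
Proof.
move=> dab; rewrite /revlex_lt dab ltnn eqxx /=; apply: (iffP existsP).
  move=> [j /andP[h1 /forallP h2]]; exists j; split=> // l jl.
  by apply/eqP; move/implyP: (h2 l); apply.
move=> [j [h1 h2]]; exists j; rewrite h1 /=; apply/forallP=> l.
by apply/implyP=> /h2 ->.
Qed.

Lemma revlex_lt_mdeg a b : revlex_lt a b -> (mdeg a <= mdeg b)%N.
Proof. by case/orP=> [/ltnW //|/andP[/eqP->]]. Qed.

Lemma revlex_lt_irr a : revlex_lt a a = false.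
Proof. by apply/negP=> /(revlex_ltP (erefl _))[j []]; rewrite ltnn. Qed.

Lemma revlex_lt_trans b a c : revlex_lt a b -> revlex_lt b c -> revlex_lt a c.
Proof.
move=> h1 h2; have d1 := revlex_lt_mdeg h1; have d2 := revlex_lt_mdeg h2.
case: (ltnP (mdeg a) (mdeg c)) => [lt|dca]; first by rewrite /revlex_lt lt.
have dab : mdeg a = mdeg b by lia.
have dbc : mdeg b = mdeg c by lia.
have dac : mdeg a = mdeg c by lia.
case/(revlex_ltP dab): h1 => j [j1 j2]; case/(revlex_ltP dbc): h2 => k [k1 k2].
apply/(revlex_ltP dac); case: (ltngtP j k) => jk.
- by exists k; split=> [|l kl]; [rewrite j2 | rewrite j2 ?k2 //; lia].
- by exists j; split=> [|l jl]; [rewrite -k2 | rewrite j2 // k2 //; lia].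
- have ejk : j = k by apply: val_inj.
  by subst k; exists j; split=> [|l jl]; [lia | rewrite j2 // k2].
Qed.

Lemma revlex_total a b : mdeg a = mdeg b -> a != b -> revlex_lt a b \/ revlex_lt b a.
Proof.
move=> dab nab; have [j0 nj0] : exists j, a j != b j.
  apply/existsP; apply: contraNT nab; rewrite negb_exists => /forallP h.
  by apply/eqP/mnmP=> l; apply/eqP; move: (h l); rewrite negbK.
case: (@arg_maxnP _ j0 (fun j => a j != b j) (fun j : 'I_n => j : nat) nj0) => j nj max.
have eqs (l : 'I_n) : (j < l)%N -> a l = b l.
  by move=> jl; apply/eqP; apply: contraTT jl => /max; rewrite -leqNgt.
case: (ltngtP (a j) (b j)) => h; last by rewrite h eqxx in nj.
- by right; apply/revlex_ltP=> //; exists j; split=> // l /eqs.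
- by left; apply/revlex_ltP=> //; exists j.
Qed.

Lemma revlex_lt_add2r c a b : revlex_lt (a + c)%MM (b + c)%MM = revlex_lt a b.
Proof.
rewrite /revlex_lt !mdegD ltn_add2r eqn_add2r; congr (_ || _ && _).
apply: eq_existsb => j; rewrite !mnmDE ltn_add2r; congr (_ && _).
by apply: eq_forallb => l; rewrite !mnmDE eqn_add2r.
Qed.

(** The witness is the last variable that occurs in [u]: its index is at least q, so [v] has
    exponent 0 there and at every later variable. *)
Lemma revlex_lt_last q u v (l : 'I_n) :
  mdeg u = mdeg v -> (q <= l)%N -> vars_lt q v -> (0 < u l)%N -> revlex_lt u v.
Proof.
move=> duv ql hv ul; apply/revlex_ltP=> //.
case: (@arg_maxnP _ l (fun j => 0 < u j)%N (fun j : 'I_n => j : nat) ul) => j nj max.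
have := max l ul => lj; exists j; split; first by rewrite hv //; lia.
move=> k jk; rewrite (hv k); last by lia.
by apply/eqP; rewrite -leqn0 leqNgt; apply: contraTN jk => /max; rewrite -leqNgt.
Qed.

(** Passing to quotients by the last variables rests on this property of the reverse lexicographic
    order: within a degree, the monomials in the first q variables form an upper set. *)
Lemma vars_lt_revlex q u v : mdeg u = mdeg v -> vars_lt q v -> revlex_lt v u -> vars_lt q u.
Proof.
move=> duv hv vu l ql; apply/eqP; rewrite -leqn0 leqNgt; apply/negP=> ul.
have := revlex_lt_trans vu (revlex_lt_last duv ql hv ul).
by rewrite revlex_lt_irr.
Qed.

Lemma revlex_lt_var (q : 'I_n) u v : mdeg u = mdeg v ->
  vars_lt q.+1 u -> vars_lt q.+1 v -> (v q < u q)%N -> revlex_lt u v.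
Proof.
move=> duv hu hv h; apply/revlex_ltP=> //; exists q; split=> // l ql.
by rewrite hu // hv.
Qed.

Lemma revlex_ge_var (q : 'I_n) u v : mdeg u = mdeg v ->
  vars_lt q.+1 u -> vars_lt q.+1 v -> revlex_lt u v -> (v q <= u q)%N.
Proof.
move=> duv hu hv h; rewrite leqNgt; apply/negP=> vq.
have := revlex_lt_trans h (revlex_lt_var (esym duv) hv hu vq).
by rewrite revlex_lt_irr.
Qed.

Lemma mnm_splitE (q : 'I_n) u : exists2 u', u = (u' + U_(q) *+ u q)%MM & u' q = 0%N.
Proof.
exists (u - U_(q) *+ u q)%MM; last by rewrite mnmBE mulmnE mnm1E eqxx mul1n subnn.
rewrite submK //; apply/mnm_lepP=> l; rewrite mulmnE mnm1E.
by case: eqP => [->|]; rewrite ?mul1n ?mul0n.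
Qed.

Lemma mdegMU (q : 'I_n) t : mdeg (U_(q) *+ t)%MM = t.
Proof. by rewrite mdegMn mdeg1 mul1n. Qed.

Lemma exists_divisor u e : (e <= mdeg u)%N -> exists2 w, (w <= u)%MM & mdeg w = e.
Proof.
elim: e => [_|e IH lte]; first by exists 0%MM; rewrite ?mdeg0 //; apply/mnm_lepP=> l; rewrite mnm0E.
case: IH => [|w wu dw]; first exact: ltnW.
have [l wl] : exists l : 'I_n, (w l < u l)%N.
  apply/existsP; apply: contraTT lte; rewrite negb_exists -leqNgt => /forallP h.
  by rewrite -dw !mdegE; apply: leq_sum => l _; rewrite leqNgt.
exists (w + U_(l))%MM; last by rewrite mdegD mdeg1 dw addn1.
apply/mnm_lepP=> k; rewrite mnmDE mnm1E; move/mnm_lepP/(_ k): wu.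
by case: eqP => [<-|]; rewrite ?addn1 ?addn0.
Qed.

Lemma lem_mdeg_eq u v : (u <= v)%MM -> (mdeg v <= mdeg u)%N -> u = v.
Proof.
move=> uv d; have := submK uv => E; have := congr1 (@mdeg n) E.
rewrite mdegD => dE; have /eqP : mdeg (v - u) = 0%N by lia.
by rewrite mdeg_eq0 => /eqP e0; rewrite -E e0 add0m.
Qed.

Lemma exists_min_gen G m : G m -> exists2 g, min_gen G g & (g <= m)%MM.
Proof.
have [d] := ubnP (mdeg m); elim: d m => // d IH m dm Gm.
have [mg|nmg] := classic (min_gen G m); first by exists m => //; apply: lepm_refl.
have [m' [m'm nm' Gm']] : exists m', [/\ (m' <= m)%MM, m' != m & G m'].
  apply: NNPP => h; apply: nmg; split=> // m' m'm nm'.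
  by apply/negP=> Gm'; apply: h; exists m'.
case: (IH m' _ Gm') => [|g mg gm'].
  rewrite ltnNge; apply: contraNN nm' => h; apply/eqP; apply: lem_mdeg_eq => //; lia.
by exists g => //; apply: lepm_trans m'm.
Qed.

End Revlex.

(** * Almost reverse lexicographic monomial ideals *)

Section Combinatorics.
Variables (n : nat) (G : pred 'X_{1..n}).
Hypothesis upG : upset G.
Implicit Types (u v w m : 'X_{1..n}) (s a b : seq nat).

Definition monomial_slp (q : 'I_n) (d i : nat) : Prop :=
  (forall u, vars_lt q.+1 u -> mdeg u = d -> G (u + U_(q) *+ i)%MM -> G u) \/
  (forall v, vars_lt q.+1 v -> mdeg v = (d + i)%N -> (v q < i)%N -> G v).

Definition revlex_nonincreasing (i : nat) : Prop :=
  forall a b, inJ G i a -> inJ G i b -> sumn a = sumn b ->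
    revlex_lt (xmon n a) (xmon n b) -> ole (fexp G b) (fexp G a).

(** If injectivity fails at [u], a minimal generator [g] divides u x_q^i but not [u], so its
    exponent at x_q exceeds that of [u]. Every [v] of the surjectivity alternative then has a
    divisor of degree deg g with a smaller exponent at x_q than [g]; this divisor lies above [g],
    hence in [G]. *)
Lemma almost_revlex_monomial_slp q d i : almost_revlex G -> monomial_slp q d i.
Proof.
move=> arG; apply: NNPP => /not_or_and[h1 h2].
apply: h1 => u hu du Gu; apply/negPn/negP => nGu; apply: h2 => v hv dv vq.
have [g [Gg ming] gle] := exists_min_gen Gu.
have gE l : (g l <= u l + (q == l) * i)%N.
  by move/mnm_lepP/(_ l): gle; rewrite mnmDE mulmnE mnm1E.
have ugq : (u q < g q)%N.
  rewrite ltnNge; apply/negP=> gq; case/negP: nGu; apply: upG Gg.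
  apply/mnm_lepP=> l; have := gE l; case: eqP => [<- _ //|_]; last by lia.
have hg : vars_lt q.+1 g.
  move=> l ql; have := gE l; rewrite hu //; case: eqP => [e|_]; last by lia.
  by move: ql; rewrite e ltnn.
have [g' Eg g'q] := mnm_splitE q g; have [v' Ev v'q] := mnm_splitE q v.
have dg : mdeg g = (mdeg g' + g q)%N by rewrite {1}Eg mdegD mdegMU.
have dv' : mdeg v = (mdeg v' + v q)%N by rewrite {1}Ev mdegD mdegMU.
have g'u : (g' <= u)%MM.
  apply/mnm_lepP=> l; have := gE l; rewrite {1}Eg mnmDE mulmnE mnm1E.
  by case: eqP => [<-|]; rewrite ?g'q //; lia.
have dg' : (mdeg g' <= d)%N by rewrite -(submK g'u) mdegD in du; lia.
have giq := gE q; rewrite eqxx mul1n in giq.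
have du' : (g q <= u q + i)%N by [].
(* As many factors as possible come from [v'], the part of [v] prime to x_q; powers of x_q fill up
   the remaining degree. Since deg v' = d + i - v_q > d >= deg g', fewer than [g q] of them are
   needed. *)
have [w' w'v dw'] := @exists_divisor n v' (minn (mdeg v') (mdeg g)) (geq_minl _ _).
have ltq : (mdeg g - mdeg w' < g q)%N by lia.
have dleg : (mdeg g <= d + i)%N.
  by have := submK gle => /(congr1 (@mdeg n)); rewrite !mdegD mdegMU; lia.
have vle : (mdeg g - mdeg w' <= v q)%N by lia.
pose w := (w' + U_(q) *+ (mdeg g - mdeg w'))%MM.
have wv : (w <= v)%MM.
  apply/mnm_lepP=> l; rewrite Ev !mnmDE leq_add //; first exact/mnm_lepP.
  by rewrite !mulmnE leq_mul2l vle orbT.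
apply: (upG wv); apply: (arG g) => //; first by rewrite mdegD mdegMU; lia.
apply: (@revlex_lt_var _ q) => //.
- by rewrite mdegD mdegMU; lia.
- by move=> l ql; apply/eqP; rewrite -leqn0 -(hv l ql); apply/mnm_lepP.
rewrite mnmDE mulmnE mnm1E eqxx mul1n.
by move/mnm_lepP/(_ q): w'v; rewrite v'q; lia.
Qed.

Lemma xmonE s (l : 'I_n) : xmon n s l = nth 0%N s l.
Proof. by rewrite mnmE. Qed.

Lemma xmon_rcons s t (j : 'I_n) : size s = j ->
  xmon n (rcons s t) = (xmon n s + U_(j) *+ t)%MM.
Proof.
move=> sj; apply/mnmP=> l; rewrite mnmDE !xmonE mulmnE mnm1E nth_rcons sj.
case: ltngtP => lj; last first.
- by rewrite -(val_inj lj) eqxx mul1n nth_default ?sj ?lj.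
- by rewrite nth_default ?sj 1?ltnW // -val_eqE /= ltn_eqF.
- by rewrite -val_eqE /= gtn_eqF // mul0n addn0.
Qed.

Lemma xmon_vars_lt s : vars_lt (size s) (xmon n s).
Proof. by move=> l sl; rewrite xmonE nth_default. Qed.

Lemma sumn_mdeg s : (size s <= n)%N -> mdeg (xmon n s) = sumn s.
Proof.
move=> sn; rewrite mdegE sumnE (big_nth 0%N) big_mkord (big_ord_widen n (nth 0%N s)) // [RHS]big_mkcond /=.
apply: eq_bigr => l _ ; rewrite xmonE; case: ltnP => // sl.
by rewrite nth_default.
Qed.

Lemma xmon_take q u : vars_lt q u -> xmon n (take q u) = u.
Proof.
move=> hu; apply/mnmP=> l; rewrite xmonE.
case: (ltnP l q) => lq; first by rewrite nth_take // -mnm_nth.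
by rewrite hu // nth_default // size_take_min; lia.
Qed.

Lemma fexp_Some s t : fexp G s = Some t ->
  G (xmon n (rcons s t)) /\ forall t', G (xmon n (rcons s t')) -> (t <= t')%N.
Proof. by rewrite /fexp; case: excluded_middle_informative => // h [<-]; case: ex_minnP. Qed.

Lemma fexp_None s t : fexp G s = None -> ~~ G (xmon n (rcons s t)).
Proof.
by rewrite /fexp; case: excluded_middle_informative => // h _; apply/negP=> Gt; apply: h; exists t.
Qed.

(** The admissible exponents are upward closed because [G] is, so lying below their minimum
    (infinity if there are none) amounts to not being one of them. *)
Lemma olt_fexp s t : olt t (fexp G s) = ~~ G (xmon n (rcons s t)).
Proof.
case E: (fexp G s) => [e|] /=; last by rewrite fexp_None.
have [Ge mine] := fexp_Some E; apply/idP/negP => [te /mine|nG]; first by lia.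
rewrite ltnNge; apply/negP=> et; apply: nG; apply: upG Ge.
apply/mnm_lepP=> l; rewrite !xmonE !nth_rcons; case: ifP => // _; by case: ifP.
Qed.

Lemma ole_fexp s t : G (xmon n (rcons s t)) -> ole (fexp G s) (Some t).
Proof.
move=> Gt; case E: (fexp G s) => [e|] /=; first by case: (fexp_Some E) => _; apply.
by move: (fexp_None t E); rewrite Gt.
Qed.

(** By [olt_fexp] this is the condition of [inJ] at the last index i - 1, an index that exists only
    for i > 0. *)
Lemma inJ_notin i s : (0 < i)%N -> inJ G i s -> ~~ G (xmon n s).
Proof.
move=> i0 [ss /(_ i.-1)]; rewrite prednK // leqnn olt_fexp => /(_ isT).
have e: (i.-1 < size s)%N by rewrite ss prednK.
by rewrite -take_nth // prednK // -ss take_size.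
Qed.

Lemma notin_inJ i u : (i <= n)%N -> vars_lt i u -> ~~ G u -> inJ G i (take i u).
Proof.
move=> lin hu nGu; have su : size (take i u) = i by rewrite size_takel ?size_tuple.
split=> // j ji; rewrite olt_fexp -take_nth ?su //; apply: contra nGu; apply: upG.
rewrite -[u in (_ <= u)%MM](xmon_take hu); apply/mnm_lepP=> l; rewrite !xmonE.
by case: (ltnP l j.+1) => lj; [rewrite nth_take | rewrite nth_default // size_take_min; lia].
Qed.

(** A minimal generator [g] dividing x^a x_j^t has exponent exactly t at x_j, since t is minimal.
    Either its cofactor is x^a, and x^b x_j^t lies above it in the same degree, or the cofactor has
    smaller degree and one factor x_j can be traded for a further factor of x^b. *)
Lemma almost_revlex_nonincreasing i : (0 < i)%N -> (i < n)%N ->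
  almost_revlex G -> revlex_nonincreasing i.
Proof.
move=> i0 iltn arG a b Ja Jb sab lab; case E: (fexp G a) => [t|]; last by case: fexp.
apply: ole_fexp; have [Gt mint] := fexp_Some E; have [sa _] := Ja; have [sb _] := Jb.
(* Variables are numbered from 0, so index i belongs to the variable that f_{i+1} refers to. *)
pose j := Ordinal iltn; have t0 : (0 < t)%N.
  rewrite lt0n; apply: contraNneq (inJ_notin i0 Ja) => t0.
  by apply: upG Gt; rewrite t0 (@xmon_rcons _ _ j) // mulm0n addm0 lepm_refl.
have Ga := Gt; rewrite (@xmon_rcons _ _ j) // in Ga.
rewrite (@xmon_rcons _ _ j) //; have [g [Gg ming] gle] := exists_min_gen Ga.
have hva : vars_lt j (xmon n a) by have := @xmon_vars_lt a; rewrite sa.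
have hvb : vars_lt j (xmon n b) by have := @xmon_vars_lt b; rewrite sb.
have gE l : (g l <= xmon n a l + (j == l) * t)%N.
  by move/mnm_lepP/(_ l): gle; rewrite mnmDE mulmnE mnm1E.
have gj : g j = t.
  have := gE j; rewrite eqxx mul1n hva // add0n => gj; apply/eqP; rewrite eqn_leq gj /=.
  apply: mint; rewrite (@xmon_rcons _ _ j) //; apply: upG Gg; apply/mnm_lepP=> l.
  have := gE l; rewrite mnmDE mulmnE mnm1E; case: eqP => [<-|//]; lia.
have dab : mdeg (xmon n a) = mdeg (xmon n b) by rewrite !sumn_mdeg ?sa ?sb // ltnW.
have hg : vars_lt j.+1 g.
  move=> l jl; have := gE l; rewrite hva; last exact: ltnW.
  by case: eqP => [e|_]; [move: jl; rewrite e ltnn | lia].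
have [g' Eg g'j] := mnm_splitE j g.
have g'a : (g' <= xmon n a)%MM.
  apply/mnm_lepP=> l; have := gE l; rewrite {1}Eg mnmDE mulmnE mnm1E.
  by case: eqP => [<-|]; rewrite ?g'j //; lia.
have := submK g'a => /(congr1 (@mdeg n)); rewrite mdegD => dg'.
have dg : mdeg g = (mdeg g' + t)%N by rewrite {1}Eg mdegD mdegMU gj.
case: (posnP (mdeg (xmon n a - g')%MM)) => [d0|dpos].
  have eg : g' = xmon n a by apply: lem_mdeg_eq => //; lia.
  apply: (arG g) => //; first by rewrite !mdegD mdegMU; lia.
  by rewrite Eg gj eg revlex_lt_add2r.
(* One factor more than in [g'], compensated by one x_j less: the smaller exponent at x_j puts the
   product above [g]. *)
have [w' w'b dw'] := @exists_divisor n (xmon n b) (mdeg g').+1 ltac:(lia).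
have wle : (w' + U_(j) *+ t.-1 <= xmon n b + U_(j) *+ t)%MM.
  apply/mnm_lepP=> l; rewrite !mnmDE leq_add //; first exact/mnm_lepP.
  by rewrite !mulmnE leq_mul2l leq_pred orbT.
have dw : mdeg (w' + U_(j) *+ t.-1)%MM = mdeg g by rewrite mdegD mdegMU; lia.
have w'0 (l : 'I_n) : (j <= l)%N -> w' l = 0%N.
  by move=> jl; apply/eqP; rewrite -leqn0 -(hvb l jl); apply/mnm_lepP.
apply: (upG wle); apply: (arG g) => //; apply: (@revlex_lt_var _ j) => //.
  move=> l jl; rewrite mnmDE w'0; last exact: ltnW.
  by rewrite mulmnE mnm1E -val_eqE /= ltn_eqF.
by rewrite mnmDE mulmnE mnm1E eqxx mul1n w'0 // gj; lia.
Qed.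

Hypothesis stG : strongly_stable G.

Lemma stable_move (i j : 'I_n) m t : (i < j)%N -> (t <= m j)%N -> G m ->
  G (m - U_(j) *+ t + U_(i) *+ t)%MM.
Proof.
move=> ij; elim: t => [|t IH] tm Gm; first by rewrite !mulm0n subm0 addm0.
have := stG ij _ (IH (ltnW tm) Gm).
have nij : (i == j) = false by rewrite -val_eqE /= ltn_eqF.
have -> : (m - U_(j) *+ t + U_(i) *+ t - U_(j) + U_(i) = m - U_(j) *+ t.+1 + U_(i) *+ t.+1)%MM.
  apply/mnmP=> l; rewrite !(mnmDE, mnmBE, mulmnE, mnm1E).
  by case: (eqVneq i l) => [e|_]; case: (eqVneq j l) => [e'|_]; rewrite ?e ?e' ?eqxx in nij *; lia.
by apply; rewrite !(mnmDE, mnmBE, mulmnE, mnm1E) nij eqxx; lia.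
Qed.

(** Equal degrees force what [v] loses at x_j to reappear at x_i, so [v] arises from [u] by
    [stable_move]. *)
Lemma stable_two_vars (i j : 'I_n) u v : (i < j)%N -> mdeg u = mdeg v ->
  (forall l : 'I_n, l != i -> l != j -> u l = v l) -> (v j <= u j)%N -> G u -> G v.
Proof.
move=> ij duv huv vj Gu.
have nji : j != i by rewrite -val_eqE /= gtn_eqF.
have := duv; rewrite !mdegE (bigD1 i) // [in RHS](bigD1 i) //= (bigD1 j) // [in RHS](bigD1 j) //=.
rewrite (eq_bigr v) => [dE|l /andP[]]; last exact: huv.
have -> : v = (u - U_(j) *+ (u j - v j) + U_(i) *+ (u j - v j))%MM.
  apply/mnmP=> l; rewrite !(mnmDE, mnmBE, mulmnE, mnm1E).
  case: (eqVneq i l) => [e|ni]; first by subst l; rewrite (negPf nji); lia.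
  case: (eqVneq j l) => [e|nj]; first by subst l; lia.
  by rewrite huv 1?eq_sym //; lia.
by apply: stable_move => //; lia.
Qed.

(** Let x_q be the last variable of the minimal generator [g]; then [M] involves no later variable
    and has at most the exponent of [g] at x_q. For q <= 1 degree and strong stability decide. For q
    >= 2 a strictly smaller exponent is settled by [monomial_slp], and equal exponents by comparing
    the cofactors of the power of x_q. *)
Lemma monomial_slp_almost_revlex :
  (forall q : 'I_n, (2 <= q)%N -> forall d i, monomial_slp q d i) ->
  (forall i, (3 <= i)%N -> (i < n)%N -> revlex_nonincreasing i) ->
  almost_revlex G.
Proof.
move=> slpG nincG g [Gg ming] M dM gM.
have [g0|gn0] := eqVneq g 0%MM.
  have /eqP : mdeg M = 0%N by rewrite dM g0 mdeg0.
  by rewrite mdeg_eq0 => /eqP M0; move: gM; rewrite M0 g0 revlex_lt_irr.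
have [j0 j0P] : exists j, (0 < g j)%N.
  apply/existsP; apply: contraNT gn0; rewrite negb_exists => /forallP h.
  by apply/eqP/mnmP=> l; rewrite mnm0E; apply/eqP; rewrite -leqn0 leqNgt.
case: (@arg_maxnP _ j0 (fun j => 0 < g j)%N (fun j : 'I_n => j : nat) j0P) => q gq max.
have hg : vars_lt q.+1 g.
  by move=> l ql; apply/eqP; rewrite -leqn0 leqNgt; apply: contraTN ql => /max; rewrite -leqNgt.
have hM := vars_lt_revlex dM hg gM.
have Mq := revlex_ge_var (esym dM) hg hM gM.
case: (leqP q 0) => [q0|q0].
  have small l : l != q -> (q < l)%N.
    by move=> lq; have : (l : nat) != q by []; lia.
  suff -> : M = g by [].
  apply/mnmP=> l; case: (eqVneq l q) => [->|/small lq]; last by rewrite hg // hM.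
  have := dM; rewrite !mdegE (bigD1 q) // [in RHS](bigD1 q) //= !big1 ?addn0 // => k /small kq; [exact: hg|exact: hM].
have lt0n : (0 < n)%N by apply: leq_trans (ltn_ord q).
case: (leqP q 1) => [q1|q1].
  apply: (@stable_two_vars (Ordinal lt0n) q g M) => // l; rewrite -!val_eqE /= => l0 lq.
  by rewrite hg ?hM //; lia.
have [u Eg uq] := mnm_splitE q g; have [w EM wq] := mnm_splitE q M.
have dg : mdeg g = (mdeg u + g q)%N by rewrite {1}Eg mdegD mdegMU.
have nGu : ~~ G u.
  apply: ming; first by rewrite [g in (_ <= g)%MM]Eg lem_addr.
  by apply: contraTneq gq => <-; rewrite uq.
have hu : vars_lt q u.
  move=> l ql; case: (eqVneq l q) => [->//|lq]; apply/eqP; rewrite -leqn0.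
  have <- : g l = 0%N by apply: hg; have : (l : nat) != q by []; lia.
  by rewrite Eg mnmDE leq_addr.
have hw : vars_lt q w.
  move=> l ql; case: (eqVneq l q) => [->//|lq]; apply/eqP; rewrite -leqn0.
  have <- : M l = 0%N by apply: hM; have : (l : nat) != q by []; lia.
  by rewrite EM mnmDE leq_addr.
move: Mq; rewrite leq_eqVlt => /orP[/eqP Mq|Mq]; last first.
  (* Injectivity of x_q^(g_q) fails at [u], as [g] is in [G] and [u] is not; the surjectivity
     alternative applies to [M]. *)
  case: (slpG q q1 (mdeg u) (g q)) => h; last by apply: h => //; rewrite dM.
  by case/negP: nGu; apply: h; rewrite -?Eg // => l ql; apply: hu; apply: ltnW.
(* For q = 2 the cofactors involve only x_0 and x_1, and strong stability does what (2) does from i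
   = 3 on. *)
case: (leqP q 2) => [q2|q2].
  have lt1n : (1 < n)%N by apply: leq_trans (ltn_ord q).
  have uw : revlex_lt u w by rewrite -(revlex_lt_add2r (U_(q) *+ g q)%MM) -Eg -[in X in revlex_lt _ X]Mq -EM.
  have duw : mdeg u = mdeg w.
    by have := dM; rewrite {1}EM {1}Eg !mdegD Mq => /addIn.
  have w1 : (w (Ordinal lt1n) <= u (Ordinal lt1n))%N.
    by apply: revlex_ge_var uw => //= l ql; [apply: hu|apply: hw]; lia.
  apply: (@stable_two_vars (Ordinal lt0n) (Ordinal lt1n) g M) => // [l|].
    rewrite -!val_eqE /= => l0 l1; case: (eqVneq l q) => [->//|lq].
    have ql : (q < l)%N by have : (l : nat) != q by []; lia.
    by rewrite hg // hM.
  have nq : (q == Ordinal lt1n) = false by rewrite -val_eqE /=; lia.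
  by rewrite EM Eg !mnmDE !mulmnE !mnm1E nq; lia.
have [Gw|nGw] := boolP (G w); first by rewrite EM; apply: upG Gw; apply: lem_addr.
have uw : revlex_lt u w by rewrite -(revlex_lt_add2r (U_(q) *+ g q)%MM) -Eg -[in X in revlex_lt _ X]Mq -EM.
have duw : mdeg u = mdeg w by have := dM; rewrite {1}EM {1}Eg !mdegD Mq => /addIn.
have su : size (take q u) = q by rewrite size_takel // size_tuple ltnW.
have sw : size (take q w) = q by rewrite size_takel // size_tuple ltnW.
have qn : (q <= n)%N by apply: ltnW.
(* With f = f_{q+1}, (2) gives f(w) <= f(u) <= g_q, so w x_q^(g_q), which is [M], lies in [G]. *)
have := nincG q q2 (ltn_ord q) (take q u) (take q w) (notin_inJ qn hu nGu) (notin_inJ qn hw nGw).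
rewrite -!sumn_mdeg ?su ?sw // !xmon_take // => /(_ duw uw).
have := @ole_fexp (take q u) (g q); rewrite (xmon_rcons _ su) xmon_take // -Eg => /(_ Gg).
case: (fexp G (take q u)) => [t|//] /= tg; case E : (fexp G (take q w)) => [t'|//] /= t't.
have [Gt' _] := fexp_Some E; apply: upG Gt'; rewrite (xmon_rcons _ sw) xmon_take // EM Mq.
by apply/mnm_lepP=> l; rewrite !mnmDE leq_add2l !mulmnE leq_mul2l; apply/orP; right; lia.
Qed.

End Combinatorics.

(** * Ideals, linear changes of coordinates and initial ideals *)

Lemma mpoly_rmorphism_ext (k : comNzRingType) n (S : nzRingType)
    (phi psi : {rmorphism {mpoly k[n]} -> S}) :
  (forall c, phi c%:MP = psi c%:MP) -> (forall i, phi 'X_i = psi 'X_i) -> phi =1 psi.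
Proof.
move=> eC eX f; rewrite (mpolyE f) !rmorph_sum; apply: eq_bigr => m _.
rewrite -!mul_mpolyC !rmorphM eC mpolyXE_id !rmorph_prod; congr (_ * _).
by apply: eq_bigr => i _; rewrite !rmorphXn /= eX.
Qed.

Lemma prod_homog (R : comNzRingType) n (I : Type) (r : seq I) (F : I -> {mpoly R[n]}) (e : I -> nat) :
  (forall i, F i \is (e i).-homog) -> \prod_(i <- r) F i \is (\sum_(i <- r) e i)%N.-homog.
Proof.
move=> hF; elim/big_rec2: _ => [|i d p _ hp]; first exact: dhomog1.
exact: dhomogM.
Qed.

Section Ideals.
Variables (k : fieldType) (n : nat).
Local Notation poly := {mpoly k[n]}.
Implicit Types (I K : poly -> Prop) (f g : poly).

Section Closure.
Variables (I : poly -> Prop) (idI : is_ideal I).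

Lemma ideal0 : I 0. Proof. by case: idI. Qed.
Lemma idealD f g : I f -> I g -> I (f + g). Proof. by case: idI => _ h _; apply: h. Qed.
Lemma idealMl f g : I g -> I (f * g). Proof. by case: idI => _ _; apply. Qed.
Lemma idealZ c f : I f -> I (c *: f). Proof. by rewrite -mul_mpolyC; apply: idealMl. Qed.
Lemma idealN f : I f -> I (- f). Proof. by rewrite -scaleN1r; apply: idealZ. Qed.
Lemma idealB f g : I f -> I g -> I (f - g). Proof. by move=> hf /idealN; apply: idealD. Qed.

Lemma ideal_sum (T : Type) (r : seq T) (P : pred T) (F : T -> poly) :
  (forall i, P i -> I (F i)) -> I (\sum_(i <- r | P i) F i).
Proof. by move=> hF; elim/big_ind: _ => //; [apply: ideal0 | apply: idealD]. Qed.

Lemma idealDr f g : I g -> I (f + g) -> I f.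
Proof. by move=> hg /idealB/(_ hg); rewrite addrK. Qed.

End Closure.

Lemma ideal_add_forms_ideal I (Ls : seq poly) : is_ideal I -> is_ideal (ideal_add_forms I Ls).
Proof.
move=> idI; split.
- exists 0, (fun=> 0); split; first exact: ideal0.
  by rewrite big1 ?addr0 // => j _; rewrite mul0r.
- move=> f g [f0 [fs [If ->]]] [g0 [gs [Ig ->]]].
  exists (f0 + g0), (fun j => fs j + gs j); split; first exact: idealD.
  by rewrite addrACA -big_split; congr (_ + _); apply: eq_bigr => j _; rewrite mulrDl.
- move=> r f [f0 [fs [If ->]]]; exists (r * f0), (fun j => r * fs j); split.
    exact: idealMl.
  by rewrite mulrDr mulr_sumr; congr (_ + _); apply: eq_bigr => j _; rewrite mulrA.
Qed.

HB.instance Definition _ (g : 'M[k]_n) :=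
  GRing.RMorphism.copy (lin_change g) (comp_mpoly [tuple \sum_(j < n) g i j *: 'X_j | i < n]).
HB.instance Definition _ (g : 'M[k]_n) :=
  GRing.Linear.copy (lin_change g) (comp_mpoly [tuple \sum_(j < n) g i j *: 'X_j | i < n]).

Lemma lin_changeC (g : 'M[k]_n) c : lin_change g c%:MP = c%:MP.
Proof. exact: comp_mpolyC. Qed.

Lemma lin_changeX (g : 'M[k]_n) i : lin_change g 'X_i = \sum_(j < n) g i j *: 'X_j.
Proof. by rewrite /lin_change comp_mpolyXU -tnth_nth tnth_mktuple. Qed.

Lemma lin_change_comp (g h : 'M[k]_n) f : lin_change h (lin_change g f) = lin_change (g *m h) f.
Proof.
apply: (@mpoly_rmorphism_ext _ _ _ (lin_change h \o lin_change g) (lin_change (g *m h))) => [c|i] /=.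
  by rewrite !lin_changeC.
rewrite !lin_changeX linear_sum /=.
under eq_bigr do rewrite linearZ /= lin_changeX scaler_sumr.
rewrite exchange_big /=; apply: eq_bigr => l _.
by rewrite mxE scaler_suml; apply: eq_bigr => j _; rewrite scalerA.
Qed.

Lemma lin_change1 f : lin_change 1%:M f = f.
Proof.
apply: (@mpoly_rmorphism_ext _ _ _ (lin_change 1%:M) idfun) => [c|i] /=; first exact: lin_changeC.
rewrite lin_changeX (bigD1 i) //= mxE eqxx scale1r big1 ?addr0 // => j ji.
by rewrite mxE eq_sym (negPf ji) scale0r.
Qed.

Lemma linear_form_homog (a : 'I_n -> k) : \sum_(j < n) a j *: 'X_j \is 1.-homog.
Proof. by apply: rpred_sum => j _; apply: rpredZ; rewrite dhomogX /= mdeg1. Qed.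

Lemma lin_changeXm_homog (g : 'M[k]_n) m : lin_change g 'X_[m] \is (mdeg m).-homog.
Proof.
rewrite /lin_change comp_mpolyX mdegE; apply: prod_homog => i.
by rewrite tnth_mktuple -[X in X.-homog]mul1n; apply: dhomogMn; apply: linear_form_homog.
Qed.

Lemma lin_change_homog (g : 'M[k]_n) d f : f \is d.-homog -> lin_change g f \is d.-homog.
Proof.
move=> /dhomogP hf; rewrite (mpolyE f) linear_sum /=; rewrite big_seq; apply: rpred_sum => m mf.
by rewrite linearZ /=; apply: rpredZ; rewrite -(hf m mf); apply: lin_changeXm_homog.
Qed.

Lemma pihomog_lin_change (g : 'M[k]_n) d f :
  pihomog mdeg d (lin_change g f) = lin_change g (pihomog mdeg d f).
Proof.
elim/mpolyind: f => [|c m f _ _ IH]; first by rewrite !linear0.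
rewrite !linearD /= IH !linearZ /= pihomogX; congr (_ *: _ + _).
case: eqP => [<-|nd]; first by rewrite pihomog_dE // lin_changeXm_homog.
by rewrite linear0 (pihomog_ne0 _ (lin_changeXm_homog g m)) //; apply/eqP.
Qed.

Lemma mcoeff_pihomog d f m : (pihomog mdeg d f)@_m = if mdeg m == d then f@_m else 0.
Proof.
elim/mpolyind: f => [|c u f _ _ IH]; first by rewrite linear0 mcoeff0 if_same.
rewrite linearD linearZ /= !mcoeffD !mcoeffZ IH pihomogX mcoeffX.
have [->|num] := eqVneq u m; first by case: ifP; rewrite ?mcoeffX ?eqxx ?mcoeff0 ?mulr0 ?addr0.
by case: (_ == d); case: (_ == d); rewrite ?mcoeffX ?(negPf num) ?mcoeff0 ?mulr0 ?add0r.
Qed.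

(** For invertible [g] this is the image of [I] under [lin_change g], written as a preimage under
    the inverse change. *)
Definition ideal_image (g : 'M[k]_n) I f := I (lin_change (invmx g) f).

Lemma ideal_image_homogeneous (g : 'M[k]_n) I : homogeneous_ideal I -> homogeneous_ideal (ideal_image g I).
Proof.
move=> [[I0 ID IM] Ih]; split; last first.
  by move=> f d; rewrite /ideal_image => /(Ih _ d); rewrite pihomog_lin_change.
rewrite /ideal_image; split=> [|f1 f2 h1 h2|r f h]; first by rewrite linear0.
- by rewrite linearD; apply: ID.
- by rewrite rmorphM; apply: IM.
Qed.

Lemma lin_changeK (g : 'M[k]_n) : g \in unitmx -> cancel (lin_change g) (lin_change (invmx g)).
Proof. by move=> ug f; rewrite lin_change_comp mulmxV // lin_change1. Qed.

Lemma lin_changeVK (g : 'M[k]_n) : g \in unitmx -> cancel (lin_change (invmx g)) (lin_change g).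
Proof. by move=> ug f; rewrite lin_change_comp mulVmx // lin_change1. Qed.

Lemma init_ideal_changeE (g : 'M[k]_n) I m : g \in unitmx ->
  init_ideal_change I g m <-> exists2 f, ideal_image g I f & lead_mon f m.
Proof.
move=> ug; split=> [[f [If lf]]|[f If lf]].
  by exists (lin_change g f) => //; rewrite /ideal_image lin_changeK.
by exists (lin_change (invmx g) f); rewrite lin_changeVK.
Qed.

Lemma exists_lead_mon d f : f \is d.-homog -> f != 0 -> exists m, lead_mon f m.
Proof.
move=> /dhomogP hf; rewrite -msupp_eq0 => nf.
have : {in msupp f, forall m, mdeg m = d} by [].
rewrite /lead_mon; elim: (msupp f) nf => // m s IH _ hs.
have [->|ns] := eqVneq s [::].
  by exists m; rewrite inE eqxx /= /revlex_le eqxx.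
case: (IH ns) => [u us|m' /andP[m's /allP mx]]; first by apply: hs; rewrite inE us orbT.
have [e|nmm'] := eqVneq m m'.
  by exists m; rewrite inE eqxx /= /revlex_le eqxx e /=; apply/allP.
have dmm' : mdeg m = mdeg m' by rewrite !hs // inE ?eqxx ?m's ?orbT.
case: (revlex_total dmm' nmm') => lt.
  by exists m'; rewrite inE m's orbT /= /revlex_le lt orbT /=; apply/allP.
exists m; rewrite inE eqxx /= {1}/revlex_le eqxx /=; apply/allP=> u /mx.
by rewrite /revlex_le => /orP[/eqP->|ult]; rewrite ?lt ?orbT // (revlex_lt_trans ult lt) orbT.
Qed.

Lemma lead_mon_supp f m : lead_mon f m -> f@_m != 0.
Proof. by case/andP; rewrite mcoeff_msupp. Qed.

Lemma lead_mon_gt f m u : lead_mon f m -> revlex_lt m u -> f@_u = 0.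
Proof.
case/andP=> _ /allP mx mu; apply: memN_msupp_eq0; apply/negP=> /mx /orP[/eqP e|um].
  by move: mu; rewrite e revlex_lt_irr.
by have := revlex_lt_trans mu um; rewrite revlex_lt_irr.
Qed.

Lemma lead_monP f m : f@_m != 0 ->
  (forall u, mdeg u = mdeg m -> revlex_lt m u -> f@_u = 0) -> f \is (mdeg m).-homog -> lead_mon f m.
Proof.
move=> fm h /dhomogP hf; rewrite /lead_mon mcoeff_msupp fm /=; apply/allP=> u uf.
have [->|nu] := eqVneq u m; first by rewrite /revlex_le eqxx.
have du := hf u uf; rewrite /revlex_le.
case: (revlex_total du nu) => [->|mu]; first by rewrite orbT.
by move: uf; rewrite mcoeff_msupp h // eqxx.
Qed.

Lemma lead_monMX f m w : f \is (mdeg m).-homog -> lead_mon f m ->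
  lead_mon ('X_[w] * f) (w + m)%MM.
Proof.
move=> hf lf; apply: lead_monP.
- by rewrite mulrC mcoeffMX lead_mon_supp.
- move=> u _ wu; apply: memN_msupp_eq0; rewrite mulrC (perm_mem (msuppMX _ _)).
  apply/negP=> /mapP[v vf Eu]; move: wu; rewrite Eu ![(w + _)%MM]addmC revlex_lt_add2r => mv.
  by move: vf; rewrite mcoeff_msupp (lead_mon_gt lf mv) eqxx.
- by rewrite mdegD; apply: dhomogM => //; rewrite dhomogX.
Qed.

End Ideals.

(** * Initial ideals modulo the last variables *)

Section InitialIdeal.
Variables (k : fieldType) (n : nat) (J : {mpoly k[n]} -> Prop) (G : pred 'X_{1..n}).
Hypotheses (homJ : homogeneous_ideal J).
Hypothesis GJ : forall m, G m <-> exists2 f, J f & lead_mon f m.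
Local Notation poly := {mpoly k[n]}.
Implicit Types (u v m : 'X_{1..n}) (f : poly).

Let idJ : is_ideal J. Proof. by case: homJ. Qed.

Lemma lead_mon_homog f m : J f -> lead_mon f m ->
  exists f', [/\ J f', f' \is (mdeg m).-homog & lead_mon f' m].
Proof.
move=> Jf lf; exists (pihomog mdeg (mdeg m) f); split.
- by case: homJ => _; apply.
- exact: pihomogP.
- apply: lead_monP; last exact: pihomogP.
    by rewrite mcoeff_pihomog eqxx lead_mon_supp.
  by move=> u du mu; rewrite mcoeff_pihomog du eqxx (lead_mon_gt lf).
Qed.

Lemma initial_ideal_upset : upset G.
Proof.
move=> u v uv /GJ[f Jf lf]; apply/GJ.
have [f' [Jf' hf' lf']] := lead_mon_homog Jf lf.
exists ('X_[v - u] * f'); first exact: idealMl.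
by rewrite -{2}(submK uv); apply: lead_monMX.
Qed.

Variable q : 'I_n.

(* Membership in [J + (x_l | l > q)], read off the coefficients. *)
Definition truncated_ideal f := exists2 j, J j & forall u, vars_lt q.+1 u -> f@_u = j@_u.

(** The element [j] of [J] that agrees with [f] on monomials in x_0, ..., x_q has no term above [m]
    in degree deg m: by [vars_lt_revlex] such monomials involve only these variables, where the
    coefficients are those of [f]. *)
Lemma truncated_lead f m : truncated_ideal f -> lead_mon f m -> vars_lt q.+1 m -> G m.
Proof.
move=> [j Jj fj] lf hm; apply/GJ; exists (pihomog mdeg (mdeg m) j).
  by case: homJ => _; apply.
apply: lead_monP; last exact: pihomogP.
  by rewrite mcoeff_pihomog eqxx -fj // lead_mon_supp.
move=> u du mu; rewrite mcoeff_pihomog du eqxx -fj; first exact: lead_mon_gt lf mu.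
exact: vars_lt_revlex mu.
Qed.

Lemma truncated_ideal_sub f : J f -> truncated_ideal f.
Proof. by exists f. Qed.

Lemma truncated_ideal_eq f g : truncated_ideal f ->
  (forall u, vars_lt q.+1 u -> g@_u = f@_u) -> truncated_ideal g.
Proof. by move=> [j Jj fj] gf; exists j => // u hu; rewrite gf // fj. Qed.

Lemma truncated_idealD f g : truncated_ideal f -> truncated_ideal g -> truncated_ideal (f + g).
Proof.
move=> [j Jj fj] [j' Jj' fj']; exists (j + j'); first exact: idealD.
by move=> u hu; rewrite !mcoeffD fj ?fj'.
Qed.

Lemma truncated_idealZ c f : truncated_ideal f -> truncated_ideal (c *: f).
Proof.
move=> [j Jj fj]; exists (c *: j); first exact: idealZ.
by move=> u hu; rewrite !mcoeffZ fj.
Qed.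

Lemma truncated_idealMXn i f : truncated_ideal f -> truncated_ideal ('X_q ^+ i * f).
Proof.
move=> [j Jj fj]; exists ('X_q ^+ i * j); first exact: idealMl.
move=> u hu; rewrite mpolyXn ![_ * f]mulrC ![_ * j]mulrC.
have [le|nle] := boolP (U_(q) *+ i <= u)%MM.
  rewrite -(submK le) addmC !mcoeffMX; apply: fj => l ql.
  by rewrite mnmBE hu // sub0n.
have z p : (p * 'X_[U_(q) *+ i])@_u = 0 :> k.
  apply: memN_msupp_eq0; rewrite (perm_mem (msuppMX _ _)).
  by apply: contra nle => /mapP[m _ ->]; apply: lem_addr.
by rewrite !z.
Qed.

(** Division algorithm: modulo the truncated ideal, every form is a combination of standard
    monomials in x_0, ..., x_q. *)
Lemma standard_reduction d f : f \is d.-homog ->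
  exists f', [/\ truncated_ideal (f - f'), f' \is d.-homog &
    forall u, u \in msupp f' -> vars_lt q.+1 u /\ ~~ G u].
Proof.
(* The number of monomials of degree at most d below [m]; it bounds the induction, since each step
   lowers the leading monomial. *)
pose rk m := #|[pred u : 'X_{1..n < d.+1} | revlex_lt u m]|.
have rk_lt m m' : mdeg m = d -> revlex_lt m m' -> (rk m < rk m')%N.
  move=> dm mm'; apply: proper_card; apply/properP; split.
    by apply/subsetP=> u; rewrite !inE => um; apply: revlex_lt_trans mm'.
  have hm : (mdeg m < d.+1)%N by rewrite dm.
  by exists (BMultinom hm); rewrite !inE //= revlex_lt_irr.
have zero : exists f', [/\ truncated_ideal (0 - f'), f' \is d.-homog &
      forall u, u \in msupp f' -> vars_lt q.+1 u /\ ~~ G u].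
  exists 0; split; [|exact: rpred0|by move=> u; rewrite msupp0].
  by rewrite subr0; apply: truncated_ideal_sub; apply: ideal0 idJ.
suff main N : forall f, f \is d.-homog -> (forall m, m \in msupp f -> (rk m < N)%N) ->
    exists f', [/\ truncated_ideal (f - f'), f' \is d.-homog &
      forall u, u \in msupp f' -> vars_lt q.+1 u /\ ~~ G u].
  move=> hf; apply: (main (#|{: 'X_{1..n < d.+1}}|).+1) => // m _.
  by rewrite ltnS; apply: max_card.
elim: N => [|N IH] {}f hf rkf; have [->|f0] := eqVneq f 0.
- exact: zero.
- by have [m /andP[/rkf]] := exists_lead_mon hf f0.
- exact: zero.
have [m lf] := exists_lead_mon hf f0.
have mf : m \in msupp f by case/andP: lf.
have dm : mdeg m = d by move/dhomogP: hf => /(_ m mf).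
have step r : r \is d.-homog -> lead_mon r m ->
    exists f1, [/\ exists c, f1 = f - c *: r, f1 \is d.-homog & forall u, u \in msupp f1 -> (rk u < N)%N].
  move=> hr lr; exists (f - (f@_m / r@_m) *: r); split.
  - by exists (f@_m / r@_m).
  - by rewrite rpredB ?rpredZ.
  move=> u uf1; have du : mdeg u = d.
    have hf1 : f - (f@_m / r@_m) *: r \is d.-homog by rewrite rpredB ?rpredZ.
    exact: (dhomog_mf hf1 uf1).
  have := rkf m mf; rewrite ltnS; apply: leq_trans; apply: rk_lt => //.
  move: uf1; rewrite mcoeff_msupp mcoeffB mcoeffZ.
  have [->|num] := eqVneq u m; first by rewrite divfK ?subrr ?eqxx // lead_mon_supp.
  case: (revlex_total (etrans du (esym dm)) num) => // mu.
  by rewrite !(lead_mon_gt _ mu) // mulr0 subrr eqxx.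
have lX : lead_mon ('X_[m] : poly) m.
  apply: lead_monP; rewrite ?dhomogX // ?mcoeffX ?eqxx ?oner_neq0 // => u _ mu.
  by rewrite mcoeffX; case: eqP => // e; move: mu; rewrite e revlex_lt_irr.
have reduce r : truncated_ideal r -> r \is d.-homog -> lead_mon r m ->
    exists f', [/\ truncated_ideal (f - f'), f' \is d.-homog &
      forall u, u \in msupp f' -> vars_lt q.+1 u /\ ~~ G u].
  move=> tr hr lr; have [f1 [[c Ef1] hf1 rkf1]] := step r hr lr.
  have [f' [t' h' s']] := IH f1 hf1 rkf1; exists f'; split=> //.
  have -> : f - f' = (f1 - f') + c *: r by rewrite Ef1 addrAC subrK.
  by apply: truncated_idealD => //; apply: truncated_idealZ.
(* A leading monomial with a variable after x_q is itself in the truncated ideal, one in [G] is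
   cancelled by an element of [J], and any other is standard and moved to the remainder. *)
have [hm|nhm] := classic (vars_lt q.+1 m); last first.
  apply: (reduce 'X_[m]) => //; last by rewrite dhomogX /= dm.
  apply: truncated_ideal_eq (truncated_ideal_sub (ideal0 idJ)) _ => u hu.
  by rewrite mcoeff0 mcoeffX; case: eqP => // e; case: nhm; rewrite e.
have [/GJ[j Jj lj]|nGm] := boolP (G m).
  have [j' [Jj' hj' lj']] := lead_mon_homog Jj lj.
  by apply: (reduce j') => //; [apply: truncated_ideal_sub | rewrite -dm].
have hX : ('X_[m] : poly) \is d.-homog by rewrite dhomogX /= dm.
have [f1 [[c Ef1] hf1 rkf1]] := step 'X_[m] hX lX.
have [f' [t' h' s']] := IH f1 hf1 rkf1; exists (f' + c *: 'X_[m]); split.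
- by rewrite opprD addrA addrAC -Ef1.
- by rewrite rpredD // rpredZ.
move=> u /msuppD_le; rewrite mem_cat => /orP[/s' //|/msuppZ_le].
by rewrite msuppX inE => /eqP->.
Qed.

(** From left to right, an element of [J] with leading monomial u x_q^i can be divided by x_q^i
    modulo the later variables. From right to left, a nonzero standard remainder of [f] with leading
    monomial m would put m x_q^i, hence m, into [G]. *)
Lemma truncated_injP d i :
  (forall f, f \is d.-homog -> truncated_ideal ('X_q ^+ i * f) -> truncated_ideal f) <->
  (forall u, vars_lt q.+1 u -> mdeg u = d -> G (u + U_(q) *+ i)%MM -> G u).
Proof.
split=> [inj u hu du /GJ[j0 Jj0 lj0]|inj f hf tf].
  have [j [Jj hj lj]] := lead_mon_homog Jj0 lj0.
  (* The quotient of [j] by x_q^i, with the terms not divisible by x_q^i dropped. *)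
  pose f := \sum_(v : 'X_{1..n < d.+1} | mdeg v == d) j@_(v + U_(q) *+ i) *: 'X_[v].
  have fE v : mdeg v = d -> f@_v = j@_(v + U_(q) *+ i).
    move=> dv; rewrite raddf_sum /=; have hv : (mdeg v < d.+1)%N by rewrite dv.
    rewrite (bigD1 (BMultinom hv)) /= ?dv ?eqxx //.
    rewrite mcoeffZ mcoeffX eqxx mulr1 big1 ?addr0 // => w /andP[_ nw].
    by rewrite mcoeffZ mcoeffX -(bmeqP w (BMultinom hv)) (negPf nw) mulr0.
  have hf : f \is d.-homog by apply: rpred_sum => v dv; rewrite rpredZ // dhomogX.
  have hui : vars_lt q.+1 (u + U_(q) *+ i)%MM.
    move=> l ql; rewrite mnmDE hu // mulmnE mnm1E -val_eqE /=; lia.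
  apply: (@truncated_lead f) => //.
    apply: inj => //; exists j => // w hw; rewrite mpolyXn mulrC.
    have [le|nle] := boolP (U_(q) *+ i <= w)%MM.
      rewrite -(submK le) addmC mcoeffMX addmC.
      have [dw|ndw] := eqVneq (mdeg (w - U_(q) *+ i)%MM) d; first by rewrite fE.
      rewrite (dhomog_nemf_coeff hf ndw) (dhomog_nemf_coeff hj) //.
      by rewrite /= !mdegD du mdegMU; apply: contraNneq ndw; lia.
    rewrite (_ : (f * _)@_w = 0); last first.
      apply: memN_msupp_eq0; rewrite (perm_mem (msuppMX _ _)).
      by apply: contra nle => /mapP[m _ ->]; apply: lem_addr.
    have [dw|ndw] := eqVneq (mdeg w) (mdeg (u + U_(q) *+ i)%MM); last first.
      by rewrite (dhomog_nemf_coeff hj).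
    (* A monomial in x_0, ..., x_q not divisible by x_q^i has a smaller exponent at x_q than the
       leading monomial of [j], so it lies above it and does not occur in [j]. *)
    rewrite (lead_mon_gt lj) //; apply: (@revlex_lt_var _ q) => //.
    rewrite mnmDE mulmnE mnm1E eqxx mul1n; apply: (leq_trans _ (leq_addl _ _)).
    rewrite ltnNge; apply: contra nle => iw; apply/mnm_lepP=> l.
    by rewrite mulmnE mnm1E; case: eqP => [<-|]; rewrite ?mul1n ?mul0n.
  apply: lead_monP; rewrite ?fE ?du //; first exact: lead_mon_supp lj.
  by move=> v dv uv; rewrite fE // (lead_mon_gt lj) // revlex_lt_add2r.
have [f' [t' hf' sf']] := standard_reduction hf.
have tXf' : truncated_ideal ('X_q ^+ i * f').
  have -> : 'X_q ^+ i * f' = 'X_q ^+ i * f + (-1) *: ('X_q ^+ i * (f - f')).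
    by rewrite scaleN1r -mulrN -mulrDr opprB addrC subrK.
  by apply: truncated_idealD => //; apply: truncated_idealZ; apply: truncated_idealMXn.
have [f'0|nf'] := eqVneq f' 0; first by move: t'; rewrite f'0 subr0.
have [m lm] := exists_lead_mon hf' nf'.
have mf' : m \in msupp f' by case/andP: lm.
have [hm nGm] := sf' m mf'.
have dm : mdeg m = d by move/dhomogP: hf' => /(_ m mf').
case/negP: nGm; apply: inj => //; apply: truncated_lead tXf' _ _.
  by rewrite mpolyXn addmC; apply: lead_monMX => //; rewrite dm.
by move=> l ql; rewrite mnmDE hm // mulmnE mnm1E -val_eqE /=; lia.
Qed.

(** From left to right, subtracting a multiple of x_q^i from the monomial [v] changes no coefficient
    at [v] or above it in its degree, since the exponents at x_q there are below i; so [v] stays the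
    leading monomial. *)
Lemma truncated_surjP d i :
  (forall h, h \is (d + i)%N.-homog ->
     exists f, f \is d.-homog /\ truncated_ideal (h - 'X_q ^+ i * f)) <->
  (forall v, vars_lt q.+1 v -> mdeg v = (d + i)%N -> (v q < i)%N -> G v).
Proof.
split=> [surj v hv dv vq|surj h hh].
  have [|f [hf tf]] := surj 'X_[v]; first by rewrite dhomogX /= dv.
  have dXf : 'X_q ^+ i * f \is (d + i)%N.-homog.
    by rewrite addnC; apply: dhomogM => //; rewrite mpolyXn dhomogX /= mdegMU.
  have zero w : vars_lt q.+1 w -> (w q < i)%N -> ('X_q ^+ i * f)@_w = 0.
    move=> hw wq; apply: memN_msupp_eq0; rewrite mpolyXn mulrC (perm_mem (msuppMX _ _)).
    by apply/negP=> /mapP[m _ Ew]; move: wq; rewrite Ew mnmDE mulmnE mnm1E eqxx; lia.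
  apply: (truncated_lead tf _ hv); apply: lead_monP.
  - by rewrite mcoeffB mcoeffX eqxx zero // subr0 oner_neq0.
  - move=> w dw vw; have hw := vars_lt_revlex dw hv vw.
    rewrite mcoeffB mcoeffX zero //; last first.
      exact: leq_ltn_trans (revlex_ge_var (esym dw) hv hw vw) vq.
    by case: eqP => [e|_]; [move: vw; rewrite e revlex_lt_irr | rewrite subr0].
  - by rewrite rpredB // ?dhomogX /= dv.
have [f' [t' hf' sf']] := standard_reduction hh.
(* The monomials of the remainder [f'] lie outside [G], so by hypothesis x_q^i divides each of them;
   [f] is the quotient. *)
pose f := \sum_(v : 'X_{1..n < d.+1} | mdeg v == d) f'@_(v + U_(q) *+ i) *: 'X_[v].
exists f; split; first by apply: rpred_sum => v dv; rewrite rpredZ // dhomogX.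
suff <- : f' = 'X_q ^+ i * f by [].
apply/mpolyP=> w; rewrite mpolyXn mulrC.
have [le|nle] := boolP (U_(q) *+ i <= w)%MM.
  rewrite -(submK le) addmC mcoeffMX addmC raddf_sum /=.
  set v := (w - _)%MM; have [dv|ndv] := eqVneq (mdeg v) d; last first.
    rewrite big1 => [|u du]; last first.
      by rewrite mcoeffZ mcoeffX; case: eqP => [e|]; [rewrite -e du in ndv | rewrite mulr0].
    by apply: (dhomog_nemf_coeff hf'); rewrite /= mdegD mdegMU; apply: contraNneq ndv; lia.
  have hv : (mdeg v < d.+1)%N by rewrite dv.
  rewrite (bigD1 (BMultinom hv)) /= ?dv ?eqxx //.
  rewrite mcoeffZ mcoeffX eqxx mulr1 big1 ?addr0 // => u /andP[_ nu].
  by rewrite mcoeffZ mcoeffX -(bmeqP u (BMultinom hv)) (negPf nu) mulr0.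
rewrite [RHS]memN_msupp_eq0; last first.
  rewrite (perm_mem (msuppMX _ _)).
  by apply: contra nle => /mapP[m _ ->]; apply: lem_addr.
apply: memN_msupp_eq0; apply/negP=> wf'; have [hw nGw] := sf' w wf'.
have dw : mdeg w = (d + i)%N by move/dhomogP: hf' => /(_ w wf').
case/negP: nGw; apply: surj => //; rewrite ltnNge; apply: contra nle => iw; apply/mnm_lepP=> l.
by rewrite mulmnE mnm1E; case: eqP => [<-|]; rewrite ?mul1n ?mul0n.
Qed.

End InitialIdeal.

(** * Semicontinuity of Lefschetz maps *)

Section LinearPredicates.
Variables (k : fieldType) (V : lmodType k) (K : V -> Prop).
Hypotheses (K0 : K 0) (KD : forall x y, K x -> K y -> K (x + y))
  (KZ : forall c x, K x -> K (c *: x)).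

Let KB x y : K x -> K y -> K (x - y).
Proof. by move=> hx hy; apply: KD => //; rewrite -scaleN1r; apply: KZ. Qed.

(** A basis of the span of [ms] modulo [K] is built greedily: [m] is kept exactly when it is not yet
    a combination, modulo [K], of the elements kept before. *)
Lemma exists_basis_mod (P : V -> Prop) (ms : seq V) : (forall x, x \in ms -> P x) ->
  exists es : seq V, [/\ forall x, x \in es -> P x,
    forall s : 'I_(size es) -> k, K (\sum_a s a *: es`_a) -> forall a, s a = 0 &
    forall c : 'I_(size ms) -> k, exists s : 'I_(size es) -> k,
      K (\sum_a c a *: ms`_a - \sum_a s a *: es`_a)].
Proof.
elim: ms => [_|m ms IH Pms].
  exists [::]; split=> // [s _ [] //|c]; exists (fun=> 0).
  by rewrite !big_ord0 subrr.
have [|es [Pes free gen]] := IH; first by move=> x xm; apply: Pms; rewrite inE xm orbT.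
have [[s0 s0P]|nspan] := classic (exists s : 'I_(size es) -> k, K (m - \sum_a s a *: es`_a)).
  exists es; split=> // c; have [s sP] := gen (fun a => c (lift ord0 a)).
  exists (fun a => c ord0 * s0 a + s a); rewrite big_ord_recl /=.
  under [X in _ - X]eq_bigr do rewrite scalerDl -scalerA.
  rewrite big_split /= -scaler_sumr opprD addrACA -scalerBr.
  by apply: KD sP; apply: KZ.
exists (m :: es); split.
- by move=> x; rewrite inE => /orP[/eqP->|/Pes//]; apply: Pms; rewrite inE eqxx.
- move=> s; rewrite big_ord_recl /= => Ks.
  have s00 : s ord0 = 0.
    apply/eqP; apply: contraPT Ks => s0 Ks; apply: nspan.
    exists (fun a => - ((s ord0)^-1 * s (lift ord0 a))).
    under eq_bigr do rewrite scaleNr -scalerA.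
    rewrite sumrN -scaler_sumr opprK -[m in m + _]scale1r -(mulVf s0) -scalerA -scalerDr.
    exact: KZ.
  rewrite s00 scale0r add0r in Ks; move=> a; case: (unliftP ord0 a) => [b ->|-> //].
  exact: free Ks b.
- move=> c; have [s sP] := gen (fun a => c (lift ord0 a)).
  exists (fun a => if unlift ord0 a is Some b then s b else c ord0).
  rewrite !big_ord_recl /= unlift_none opprD addrACA subrr add0r.
  by under [X in _ - X]eq_bigr do rewrite liftK.
Qed.

(** Elimination, for the intersection of [K] with the span of [ms]: an element of [K] with
    coefficient 1 at the first vector, if there is one, clears that coefficient; otherwise the
    coefficient vanishes on all of [K]. *)
Lemma exists_spanning_seq (ms : seq V) :
  exists es : seq V, (forall x, x \in es -> K x) /\
    forall c : 'I_(size ms) -> k, K (\sum_a c a *: ms`_a) ->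
      exists s : 'I_(size es) -> k, \sum_a c a *: ms`_a = \sum_a s a *: es`_a.
Proof.
elim: ms => [|m ms [es [Kes gen]]].
  by exists [::]; split=> // c _; exists (fun=> 0); rewrite !big_ord0.
have [[c0 Kc0]|nex] := classic (exists c : 'I_(size ms) -> k, K (m + \sum_a c a *: ms`_a)).
  set p := m + _ in Kc0; exists (p :: es); split.
    by move=> x; rewrite inE => /orP[/eqP->|/Kes].
  move=> c; rewrite big_ord_recl /= => Kc.
  have E : \sum_a (c (lift ord0 a) - c ord0 * c0 a) *: ms`_a =
      c ord0 *: m + \sum_(a < size ms) c (lift ord0 a) *: ms`_a - c ord0 *: p.
    under eq_bigr do rewrite scalerBl -scalerA.
    by rewrite sumrB -scaler_sumr scalerDr opprD addrACA subrr add0r.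
  have [|s sE] := gen (fun a => c (lift ord0 a) - c ord0 * c0 a).
    by rewrite E; apply: KB => //; apply: KZ.
  exists (fun a => if unlift ord0 a is Some b then s b else c ord0).
  rewrite [RHS]big_ord_recl /= unlift_none.
  under [in RHS]eq_bigr do rewrite liftK.
  by rewrite -sE E [RHS]addrC subrK.
exists es; split=> // c; rewrite big_ord_recl /=.
have [->|c0] := eqVneq (c ord0) 0; first by rewrite scale0r add0r; apply: gen.
move=> Kc; case: nex; exists (fun a => (c ord0)^-1 * c (lift ord0 a)).
under eq_bigr do rewrite -scalerA.
rewrite -scaler_sumr -[m in m + _]scale1r -(mulVf c0) -scalerA -scalerDr.
exact: KZ.
Qed.

End LinearPredicates.

(** In characteristic 0 the integers 0, ..., [size p] - 1 have distinct images, more of them than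
    the degree of [p]. *)
Lemma poly_nonroot (k : fieldType) (p : {poly k}) : [pchar k] =i pred0 -> p != 0 -> exists t, p.[t] != 0.
Proof.
move=> ch0 p0; pose rs : seq k := [seq j%:R | j <- iota 0 (size p)].
have urs : uniq rs.
  rewrite map_inj_uniq ?iota_uniq // => i j.
  wlog ij : i j / (i <= j)%N => [W e|/eqP]; first by case/orP: (leq_total i j) => /W; [|symmetry]; auto.
  rewrite eq_sym -subr_eq0 -natrB // => /eqP e; apply/eqP; rewrite eqn_leq ij /= leqNgt.
  by apply/negP=> lt; move/pcharf0P: ch0 => /(_ (j - i)%N); rewrite e eqxx subn_eq0 leqNgt lt.
have [/(max_poly_roots p0)/(_ urs)|] := boolP (all (root p) rs).
  by rewrite size_map size_iota ltnn.
by rewrite -has_predC => /hasP[t _ /= nt]; exists t.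
Qed.

Lemma map_mx_hornerC (R : comNzRingType) m n (B : 'M[R]_(m, n)) t :
  map_mx (horner_eval t) (map_mx polyC B) = B.
Proof. by apply/matrixP=> a b; rewrite !mxE /horner_eval hornerC. Qed.

Section Semicontinuity.
Variables (k : fieldType) (n : nat) (K : {mpoly k[n]} -> Prop).
Hypothesis idK : is_ideal K.
Local Notation poly := {mpoly k[n]}.

Definition monomials d : seq poly :=
  [seq 'X_[u : 'X_{1..n}] | u : 'X_{1..n < d.+1} <- index_enum 'X_{1..n < d.+1} & mdeg u == d].

Lemma monomials_homog d f : f \in monomials d -> f \is d.-homog.
Proof. by case/mapP=> u; rewrite mem_filter => /andP[/eqP du _] ->; rewrite dhomogX /= du. Qed.

Lemma homog_monomials d f : f \is d.-homog ->
  exists c : 'I_(size (monomials d)) -> k, f = \sum_a c a *: (monomials d)`_a.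
Proof.
move=> hf; have -> : f = \sum_(u : 'X_{1..n < d.+1} | mdeg u == d) f@_u *: 'X_[u].
  apply/mpolyP=> m; rewrite raddf_sum /=; have [dm|ndm] := eqVneq (mdeg m) d; last first.
    rewrite (dhomog_nemf_coeff hf ndm) big1 // => u /eqP du; rewrite mcoeffZ mcoeffX.
    by case: eqP => [e|_]; [rewrite -e du eqxx in ndm | rewrite mulr0].
  have hm : (mdeg m < d.+1)%N by rewrite dm.
  rewrite (bigD1 (BMultinom hm)) /= ?dm ?eqxx // mcoeffZ mcoeffX eqxx mulr1 big1 ?addr0 //.
  by move=> w /andP[_ nw]; rewrite mcoeffZ mcoeffX -(bmeqP w (BMultinom hm)) (negPf nw) mulr0.
pose us := [seq u : 'X_{1..n < d.+1} <- index_enum 'X_{1..n < d.+1} | mdeg u == d].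
exists (fun a : 'I__ => f@_(nth (@bm0 n d) us a)).
rewrite -big_filter -/us (big_nth (@bm0 n d)) big_mkord.
rewrite /monomials -/us; move: (size_map (fun u : 'X_{1..n < d.+1} => 'X_[k, u] : poly) us) => e.
rewrite -(big_mkord xpredT (fun a => f@_(nth (@bm0 n d) us a) *: [seq 'X_[u : 'X_{1..n}] | u : 'X_{1..n < d.+1} <- us]`_a)) e big_mkord.
by apply: eq_bigr => a _; rewrite (nth_map (@bm0 n d)).
Qed.

Lemma exists_homog_basis_mod d : exists es : seq poly,
  [/\ forall x, x \in es -> x \is d.-homog,
    forall s : 'I_(size es) -> k, K (\sum_a s a *: es`_a) -> forall a, s a = 0 &
    forall f, f \is d.-homog -> exists s : 'I_(size es) -> k, K (f - \sum_a s a *: es`_a)].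
Proof.
have [es [hes free gen]] := exists_basis_mod (ideal0 idK) (@idealD _ _ _ idK)
  (@idealZ _ _ _ idK) (@monomials_homog d).
by exists es; split=> // f /homog_monomials[c ->]; apply: gen.
Qed.

Variables (L D : poly) (i : nat).
Hypotheses (hL : L \is 1.-homog) (hD : D \is 1.-homog).

Let hLt t : (L + t *: D) ^+ i \is i.-homog.
Proof. by rewrite -[X in X.-homog]mul1n; apply: dhomogMn; rewrite rpredD ?rpredZ. Qed.

(** The matrix of multiplication by (L + tD)^i in degree d modulo [K], with entries polynomial in t:
    the product is expanded in powers of t and coordinates are taken coefficient by coefficient. *)
Lemma multiplication_matrix d (es fs : seq poly) :
  (forall x, x \in es -> x \is d.-homog) ->
  (forall f, f \is (d + i)%N.-homog -> exists s : 'I_(size fs) -> k, K (f - \sum_b s b *: fs`_b)) ->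
  exists T : 'M[{poly k}]_(size es, size fs), forall t (s : 'rV[k]_(size es)),
    K ((L + t *: D) ^+ i * (\sum_a s 0 a *: es`_a) -
       \sum_b (s *m map_mx (horner_eval t) T) 0 b *: fs`_b).
Proof.
move=> hes gen.
pose C a := (L%:P + 'X * D%:P) ^+ i * (es`_a)%:P : {poly poly}.
(* Chosen coordinates modulo [K]; passing first to the component of degree d + i makes the choice
   available for every polynomial. *)
have [nf nfP] : exists nf : poly -> 'I_(size fs) -> k,
    forall f, K (pihomog mdeg (d + i) f - \sum_b nf f b *: fs`_b).
  have ex f := gen _ (pihomogP mdeg (d + i)%N f).
  by exists (fun f => proj1_sig (constructive_indefinite_description _ (ex f))) => f; case: constructive_indefinite_description.
exists (\matrix_(a, b) \poly_(j < size (C a)) nf (C a)`_j b) => t s.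
have row (a : 'I_(size es)) : K ((L + t *: D) ^+ i * es`_a -
    \sum_b (\poly_(j < size (C a)) nf (C a)`_j b).[t] *: fs`_b).
  have -> : (L + t *: D) ^+ i * es`_a = \sum_(j < size (C a)) t ^+ j *: pihomog mdeg (d + i) (C a)`_j.
    have h : (L + t *: D) ^+ i * es`_a \is (d + i)%N.-homog.
      by rewrite addnC; apply: dhomogM; [exact: hLt | apply: hes; apply: mem_nth].
    rewrite -(pihomog_dE h) (_ : _ * _ = (C a).[t%:MP]); last first.
      by rewrite /C hornerM horner_exp hornerD hornerM !hornerC hornerX mul_mpolyC.
    rewrite horner_coef linear_sum; apply: eq_bigr => j _.
    by rewrite -rmorphXn /= mulrC mul_mpolyC linearZ.
  under [X in _ - X]eq_bigr do rewrite horner_poly scaler_suml.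
  rewrite exchange_big /= -sumrB; apply: ideal_sum => // j _.
  under eq_bigr do rewrite mulrC -scalerA.
  by rewrite -scaler_sumr -scalerBr; apply: idealZ.
have -> : (L + t *: D) ^+ i * (\sum_a s 0 a *: es`_a) -
      \sum_b (s *m map_mx (horner_eval t) (\matrix_(a, b) \poly_(j < size (C a)) nf (C a)`_j b)) 0 b *: fs`_b =
    \sum_a s 0 a *: ((L + t *: D) ^+ i * es`_a -
    \sum_b (\poly_(j < size (C a)) nf (C a)`_j b).[t] *: fs`_b).
  rewrite mulr_sumr; under [RHS]eq_bigr do rewrite scalerBr scaler_sumr.
  rewrite sumrB; congr (_ - _); first by apply: eq_bigr => a _; rewrite scalerAr.
  rewrite exchange_big /=; apply: eq_bigr => b _; rewrite mxE scaler_suml.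
  by apply: eq_bigr => a _; rewrite !mxE scalerA.
by apply: ideal_sum => // a _; apply: idealZ.
Qed.

(** At t = 0 the matrix [T] has a right inverse [B] over k. Then det(T B) is a polynomial in t with
    value 1 at 0, and where it does not vanish [T] is still injective. *)
Lemma injective_generic d :
  (forall f, f \is d.-homog -> K (L ^+ i * f) -> K f) ->
  exists2 p : {poly k}, p != 0 & forall t, p.[t] != 0 ->
    forall f, f \is d.-homog -> K ((L + t *: D) ^+ i * f) -> K f.
Proof.
move=> inj; have [es [hes efree egen]] := exists_homog_basis_mod d.
have [fs [hfs ffree fgen]] := exists_homog_basis_mod (d + i).
have [T TP] := multiplication_matrix hes fgen.
have hsum (s : 'rV[k]_(size es)) : \sum_a s 0 a *: es`_a \is d.-homog.
  by apply: rpred_sum => a _; rewrite rpredZ // hes // mem_nth.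
have /row_freeP[B TB] : row_free (map_mx (horner_eval 0) T).
  apply: inj_row_free => v vT; have := TP 0 v; rewrite vT.
  rewrite [X in _ - X]big1 => [|b _]; last by rewrite mxE scale0r.
  rewrite subr0 scale0r addr0 => /(inj _ (hsum v))/efree v0.
  by apply/rowP=> a; rewrite mxE v0.
exists (\det (T *m map_mx polyC B)) => [|t].
  apply: contraTneq (oner_neq0 k) => p0; rewrite negbK -(det1 k (size es)) -TB.
  by rewrite -[B](map_mx_hornerC _ 0) -map_mxM det_map_mx p0 rmorph0.
rewrite -/(horner_eval t _) -det_map_mx map_mxM /= map_mx_hornerC => nz f hf Kf.
have [s sP] := egen f hf; pose v := \row_a s a.
have sv : \sum_a v 0 a *: es`_a = \sum_a s a *: es`_a by apply: eq_bigr => a _; rewrite mxE.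
have KLv : K ((L + t *: D) ^+ i * \sum_a v 0 a *: es`_a).
  have -> : (L + t *: D) ^+ i * (\sum_a v 0 a *: es`_a) =
      (L + t *: D) ^+ i * f - (L + t *: D) ^+ i * (f - \sum_a s a *: es`_a).
    by rewrite sv mulrBr subKr.
  by apply: idealB => //; apply: idealMl.
have Kv : K (\sum_b (v *m map_mx (horner_eval t) T) 0 b *: fs`_b).
  by have := idealB idK KLv (TP t v); rewrite subKr.
have vT0 : v *m map_mx (horner_eval t) T = 0 by apply/rowP=> b; rewrite (ffree _ Kv) mxE.
have v0 : v = 0.
  have u : map_mx (horner_eval t) T *m B \in unitmx by rewrite unitmxE unitfE.
  by rewrite -[v](mulmxK u) mulmxA vT0 !mul0mx.
apply: (idealDr idK _ (g := - \sum_a s a *: es`_a)) => //; rewrite -sv v0.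
by rewrite big1 ?oppr0 => [|a _]; [exact: ideal0 | rewrite mxE scale0r].
Qed.

(** The argument of [injective_generic] with a left inverse [B] and det(B T). *)
Lemma surjective_generic d :
  (forall h, h \is (d + i)%N.-homog -> exists f, f \is d.-homog /\ K (h - L ^+ i * f)) ->
  exists2 p : {poly k}, p != 0 & forall t, p.[t] != 0 ->
    forall h, h \is (d + i)%N.-homog -> exists f, f \is d.-homog /\ K (h - (L + t *: D) ^+ i * f).
Proof.
move=> surj; have [es [hes efree egen]] := exists_homog_basis_mod d.
have [fs [hfs ffree fgen]] := exists_homog_basis_mod (d + i).
have [T TP] := multiplication_matrix hes fgen.
have /row_fullP[B BT] : row_full (map_mx (horner_eval 0) T).
  rewrite -sub1mx; apply/row_subP=> b; apply/submxP.
  have [f [hf Kf]] := surj fs`_b (hfs _ (mem_nth _ (ltn_ord b))).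
  have [s sP] := egen f hf; exists (\row_a s a).
  have Kb : K (fs`_b - \sum_c (\row_a s a *m map_mx (horner_eval 0) T) 0 c *: fs`_c).
    have := TP 0 (\row_a s a); rewrite scale0r addr0 => h1.
    have -> : fs`_b = (fs`_b - L ^+ i * f) + L ^+ i * (f - \sum_a s a *: es`_a)
        + L ^+ i * \sum_a (\row_a s a) 0 a *: es`_a.
      by under [X in _ + _ * X]eq_bigr do rewrite mxE; rewrite mulrBr addrA subrK subrK.
    by rewrite -addrA; apply: idealD => //; apply: idealD => //; apply: idealMl.
  have Kb' : K (\sum_c ((row b 1%:M - \row_a s a *m map_mx (horner_eval 0) T) 0 c) *: fs`_c).
    under eq_bigr do rewrite mxE [X in (_ + X) *: _]mxE scalerBl.
    rewrite sumrB (bigD1 b) //= big1 => [|c nc]; last first.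
      by rewrite !mxE eq_sym (negPf nc) scale0r.
    by rewrite !mxE eqxx scale1r addr0.
  by apply/eqP; rewrite -subr_eq0; apply/eqP/rowP=> c; rewrite (ffree _ Kb') mxE.
exists (\det (map_mx polyC B *m T)) => [|t].
  apply: contraTneq (oner_neq0 k) => p0; rewrite negbK -(det1 k (size fs)) -BT.
  by rewrite -[B](map_mx_hornerC _ 0) -map_mxM det_map_mx p0 rmorph0.
rewrite -/(horner_eval t _) -det_map_mx map_mxM /= map_mx_hornerC => nz h hh.
have u : B *m map_mx (horner_eval t) T \in unitmx by rewrite unitmxE unitfE.
have [s sP] := fgen h hh; pose v := \row_b s b *m invmx (B *m map_mx (horner_eval t) T) *m B.
exists (\sum_a v 0 a *: es`_a); split.
  by apply: rpred_sum => a _; rewrite rpredZ // hes // mem_nth.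
have := idealB idK sP (TP t v); rewrite opprB.
have -> : \sum_b (v *m map_mx (horner_eval t) T) 0 b *: fs`_b = \sum_b s b *: fs`_b.
  by rewrite -mulmxA mulmxKV //; apply: eq_bigr => b _; rewrite mxE.
by rewrite addrA subrK.
Qed.

End Semicontinuity.

(** * Linear systems over a domain *)

Section Fractions.
Variable A : idomainType.
Local Notation "x %:F" := (@FracField.tofrac A x).
Local Open Scope quotient_scope.

Lemma fraction_clear (z : {fraction A}) : exists2 d, d != 0 & exists a, d%:F * z = a%:F.
Proof.
elim/quotW: z => x; exists (frac x).2; first exact: denom_ratioP.
exists (frac x).1; apply/eqP.
rewrite -[_ * _]/(FracField.mul _ _) !piE FracField.equivfE /FracField.mulf.
by rewrite !numden_Ratio ?mul1r ?oner_neq0 ?denom_ratioP // mulr1 mulrC.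
Qed.

Lemma fraction_clear_seq (T : eqType) (r : seq T) (F : T -> {fraction A}) :
  exists2 d, d != 0 & forall i, i \in r -> exists a, d%:F * F i = a%:F.
Proof.
elim: r => [|i r [d d0 dP]]; first by exists 1; rewrite ?oner_neq0.
have [e e0 [a ea]] := fraction_clear (F i).
exists (e * d); first by rewrite mulf_neq0.
move=> j; rewrite inE tofracM => /orP[/eqP->|/dP[b db]].
  by exists (d * a); rewrite tofracM -ea mulrCA mulrA.
by exists (e * b); rewrite tofracM -db mulrA.
Qed.

Lemma fraction_clear_mx m n (M : 'M[{fraction A}]_(m, n)) :
  exists2 d, d != 0 & exists M' : 'M[A]_(m, n), d%:F *: M = map_mx (@FracField.tofrac A) M'.
Proof.
have [d d0 dP] := fraction_clear_seq (index_enum _) (fun ij : 'I_m * 'I_n => M ij.1 ij.2).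
exists d => //; have h ij := dP ij (mem_index_enum ij).
exists (\matrix_(i, j) proj1_sig (constructive_indefinite_description _ (h (i, j)))).
by apply/matrixP=> i j; rewrite !mxE; case: constructive_indefinite_description.
Qed.

(** Over the fraction field, [Q] is in the column span of [B] or some row vector kills [B] but not
    [Q]; the second kind of vector is found in the cokernel of the transpose of [B]. Clearing
    denominators gives the statement over [A]. *)
Lemma kernel_or_image s N (B : 'M[A]_(s, N)) (Q : 'cV[A]_s) :
  (exists2 x : 'rV_s, x *m B = 0 & (x *m Q) 0 0 != 0) \/
  (exists2 d, d != 0 & exists y : 'cV_N, d *: Q = B *m y).
Proof.
have inj p q (M1 M2 : 'M[A]_(p, q)) :
    map_mx (@FracField.tofrac A) M1 = map_mx (@FracField.tofrac A) M2 -> M1 = M2.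
  by move=> /matrixP e; apply/matrixP=> i j; have := e i j; rewrite !mxE => /eqP; rewrite tofrac_eq => /eqP.
set B' := map_mx (@FracField.tofrac A) B; set Q' := map_mx (@FracField.tofrac A) Q.
have [/submxP[y Ey]|] := boolP (Q'^T <= B'^T)%MS.
  right; have [d d0 [y' dy]] := fraction_clear_mx y^T; exists d => //; exists y'.
  apply: inj; rewrite map_mxM -dy map_mxZ -scalemxAr; congr (_ *: _).
  by rewrite -[map_mx _ Q]trmxK Ey trmx_mul trmxK.
rewrite submxE => /eqP nz; left; pose C := (cokermx B'^T)^T.
have CB : C *m B' = 0 by rewrite -[B']trmxK -trmx_mul mulmx_coker trmx0.
have [j nzj] : exists j, (C *m Q') j 0 != 0.
  apply/existsP; apply/existsPn => z; apply: nz; apply: trmx_inj.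
  rewrite trmx_mul trmxK trmx0; apply/colP=> j; rewrite [RHS]mxE; apply/eqP.
  by move: (z j); rewrite negbK.
have [d d0 [x dx]] := fraction_clear_mx (row j C); exists x.
  by apply: inj; rewrite map_mxM -dx -scalemxAl -row_mul CB row0 scaler0 map_mx0.
rewrite -tofrac_eq0; have -> : ((x *m Q) 0 0)%:F = (map_mx (@FracField.tofrac A) (x *m Q)) 0 0 by rewrite [RHS]mxE.
by rewrite map_mxM -dx -scalemxAl mxE mulf_neq0 ?tofrac_eq0 // -row_mul mxE.
Qed.

End Fractions.

(** * Strong stability *)

Section Shear.
Variables (k : fieldType) (n : nat) (i j : 'I_n).
Hypothesis ij : (i < j)%N.
Local Notation poly := {mpoly k[n]}.
Local Notation kt := {poly k}.
Local Notation family := {mpoly kt[n]}.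

Definition shear (t : k) : 'M[k]_n := 1%:M + t *: delta_mx j i.

(** The shear with t kept as the indeterminate of the coefficient ring, so that derivatives in t
    make sense. *)
Definition shear_family : poly -> family :=
  mmap (@mpolyC n kt \o polyC) (fun l => 'X_l + (if l == j then 'X%:MP * 'X_i else 0)).
HB.instance Definition _ := GRing.RMorphism.copy shear_family
  (mmap (@mpolyC n kt \o polyC) (fun l => 'X_l + (if l == j then 'X%:MP * 'X_i else 0))).

Lemma shear_familyC c : shear_family c%:MP = (c%:P)%:MP.
Proof. exact: mmapC. Qed.

Lemma shear_familyX l : shear_family 'X_l = 'X_l + (if l == j then 'X%:MP * 'X_i else 0).
Proof. by rewrite /shear_family mmapX mmap1U. Qed.

Lemma shear_family_eval t f : map_mpoly (horner_eval t) (shear_family f) = lin_change (shear t) f.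
Proof.
apply: (@mpoly_rmorphism_ext _ _ _ (map_mpoly (horner_eval t) \o shear_family) (lin_change (shear t))) => [c|l] /=.
  rewrite shear_familyC map_mpolyC lin_changeC. by rewrite /= /horner_eval hornerC.
rewrite shear_familyX lin_changeX rmorphD /= map_mpolyX.
under eq_bigr do rewrite !mxE scalerDl.
rewrite big_split /= (bigD1 l) //= eqxx scale1r big1 ?addr0 => [|a al]; last first.
  by rewrite eq_sym (negPf al) scale0r.
congr (_ + _); rewrite (bigD1 i) //= eqxx andbT big1 ?addr0 => [|a ai]; last first.
  by rewrite (negPf ai) andbF mulr0 scale0r.
case: (l == j); last by rewrite rmorph0 mulr0 scale0r.
by rewrite rmorphM /= map_mpolyC map_mpolyX /= /horner_eval hornerX mulr1 mul_mpolyC.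
Qed.

Lemma shear_coef t f u : (lin_change (shear t) f)@_u = ((shear_family f)@_u).[t].
Proof. by rewrite -shear_family_eval mcoeff_map_mpoly. Qed.

Definition deriv_t : family -> family := map_mpoly (@deriv k).

Lemma deriv_t_coef F u : (deriv_t F)@_u = (F@_u)^`().
Proof. exact: mcoeff_map_mpoly. Qed.

Lemma deriv_tD F H : deriv_t (F + H) = deriv_t F + deriv_t H.
Proof. exact: raddfD. Qed.

Lemma deriv_tM F H : deriv_t (F * H) = deriv_t F * H + F * deriv_t H.
Proof.
apply/mpolyP=> u; rewrite deriv_t_coef mcoeffD !mcoeffM raddf_sum -big_split.
by apply: eq_bigr => w _; rewrite /= !deriv_t_coef derivM.
Qed.

Lemma deriv_tC (c : k) : deriv_t (c%:P)%:MP = 0.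
Proof. by rewrite /deriv_t map_mpolyC /= derivC mpolyC0. Qed.

Lemma deriv_tX l : deriv_t 'X_l = 0.
Proof. by apply/mpolyP=> u; rewrite deriv_t_coef mcoeffX mcoeff0; case: (_ == _); rewrite ?derivC ?deriv0. Qed.

(** Chain rule for x_j + t x_i. Both sides are additive in f and obey the same Leibniz rule along
    [shear_family], so constants and variables suffice. *)
Lemma deriv_shear_family f :
  deriv_t (shear_family f) = 'X_i * (shear_family f)^`M(j).
Proof.
pose Z f := deriv_t (shear_family f) = 'X_i * (shear_family f)^`M(j).
have ZD f1 f2 : Z f1 -> Z f2 -> Z (f1 + f2).
  by rewrite /Z rmorphD /= deriv_tD linearD mulrDr => -> ->.
have ZM f1 f2 : Z f1 -> Z f2 -> Z (f1 * f2).
  rewrite /Z rmorphM /= deriv_tM mderivM mulrDr => -> ->.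
  by congr (_ + _); [rewrite mulrA | rewrite mulrCA].
have ZC c : Z c%:MP.
  by rewrite /Z shear_familyC deriv_tC mderivC mulr0.
have ZX l : Z 'X_l.
  rewrite /Z shear_familyX deriv_tD deriv_tX add0r linearD /= mderivX mnm1E.
  case: eqP => [->|_]; last by rewrite scale0r add0r /deriv_t raddf0 linear0 mulr0.
  rewrite deriv_tM deriv_tX mulr0 addr0 /deriv_t map_mpolyC /= derivX mpolyC1 mul1r.
  rewrite mderiv_mulC mderivX mnm1E -val_eqE /= ltn_eqF // scale0r mulr0 addr0 scale1r.
  by rewrite (_ : U_(j) - U_(j) = 0)%MM ?mpolyX0 ?mulr1 //; apply/mnmP=> a; rewrite mnmBE subnn mnm0E.
have Z1 : Z 1 by have := ZC 1; rewrite mpolyC1.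
have Z0 : Z 0 by have := ZC 0; rewrite mpolyC0.
suff : forall h, Z h by apply.
clearbody Z; move=> h; apply: (@mpolyind _ _ Z) => // c m p _ _ Zp.
apply: ZD => //; rewrite -mul_mpolyC; apply: (ZM _ _) => //; rewrite mpolyXE_id.
apply: (big_ind Z Z1 ZM) => l _; elim: (m l) => [|e IH]; first by rewrite expr0.
by rewrite exprS; apply: ZM.
Qed.

Lemma mcoeff_mulX (R : comNzRingType) (F : {mpoly R[n]}) u :
  ('X_i * F)@_u = if (0 < u i)%N then F@_(u - U_(i)) else 0.
Proof.
rewrite mulrC; case: ifP => ui.
  have le : (U_(i) <= u)%MM by rewrite lep1mP -lt0n.
  by rewrite -{1}(submK le) addmC mcoeffMX.
apply: memN_msupp_eq0; rewrite (perm_mem (msuppMX _ _)); apply/negP=> /mapP[m _ e].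
by move: ui; rewrite e mnmDE mnm1E eqxx.
Qed.

(** The polynomial [p] cuts out the shears with initial ideal [G]; since it is nonzero, t can be
    chosen subject to one further polynomial condition. *)
Lemma shear_stable (J : poly -> Prop) (G : pred 'X_{1..n}) (p : kt) :
  [pchar k] =i pred0 -> homogeneous_ideal J -> p != 0 ->
  (forall t, p.[t] != 0 -> forall m, G m <-> exists2 f, J f & lead_mon (lin_change (shear t) f) m) ->
  forall m : 'X_{1..n}, (0 < m j)%N -> G m -> G (m - U_(j) + U_(i))%MM.
Proof.
move=> ch0 [idJ homJ] p0 Gt m mj Gm; set d := mdeg m; pose v0 := (m - U_(j) + U_(i))%MM.
(* [ps] spans the degree d part of [J]; its combinations over k[t] are the families h(t). *)
have [ps [Kps gen]] := @exists_spanning_seq _ _ (fun f : poly => J f /\ f \is d.-homog)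
  (fun x y hx hy => conj (idealD idJ hx.1 hy.1) (rpredD hx.2 hy.2))
  (fun c x hx => conj (idealZ idJ c hx.1) (rpredZ c hx.2)) (monomials k n d).
have Jps (a : 'I_(size ps)) : J ps`_a by case: (Kps ps`_a) => //; apply: mem_nth.
have hps (a : 'I_(size ps)) : ps`_a \is d.-homog by case: (Kps ps`_a) => //; apply: mem_nth.
pose us := [seq u : 'X_{1..n < d.+1} <- index_enum 'X_{1..n < d.+1} | (mdeg u == d) && revlex_lt m u].
pose B : 'M[kt]_(size ps, size us) := \matrix_(a, b) (shear_family ps`_a)@_(nth (@bm0 n d) us b).
pose Q : 'cV[kt]_(size ps) := \col_a (shear_family ps`_a)@_m.
have usP u : mdeg u = d -> revlex_lt m u -> exists b : 'I_(size us), nth (@bm0 n d) us b = u :> 'X_{1..n}.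
  move=> du mu; have hu : (mdeg u < d.+1)%N by rewrite du.
  have uus : BMultinom hu \in us by rewrite mem_filter /= du eqxx mu mem_index_enum.
  by rewrite -index_mem in uus; exists (Ordinal uus); rewrite /= nth_index // -index_mem.
have usE (b : 'I_(size us)) : mdeg (nth (@bm0 n d) us b) = d /\ revlex_lt m (nth (@bm0 n d) us b).
  by have := mem_nth (@bm0 n d) (ltn_ord b); rewrite mem_filter => /andP[/andP[/eqP]].
(* Either a combination of the [ps] over k[t] has leading monomial [m] along the whole
   shear, or the coefficient at [m] is generically a combination of the coefficients
   above [m], so that [m] cannot be a leading monomial for generic t. *)
case: (kernel_or_image B Q) => [[x xB xQ]|[dl dl0 [y Ey]]]; last first.
  have [t] := poly_nonroot ch0 (mulf_neq0 p0 dl0); rewrite hornerM mulf_eq0 negb_or => /andP[pt dlt].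
  have /(Gt t pt)[f Jf lf] := Gm.
  have hf' := pihomogP mdeg d f; have [c fE] := homog_monomials hf'.
  have [|s sE] := gen c; first by rewrite -fE; split=> //; apply: homJ.
  have coef u : mdeg u = d -> (lin_change (shear t) f)@_u =
      \sum_a s a * ((shear_family ps`_a)@_u).[t].
    move=> du; transitivity (lin_change (shear t) (pihomog mdeg d f))@_u.
      by rewrite -pihomog_lin_change mcoeff_pihomog du eqxx.
    rewrite fE sE [X in X@_u]linear_sum raddf_sum; apply: eq_bigr => a _.
    by rewrite linearZ /= mcoeffZ shear_coef.
  suff /eqP : dl.[t] * (lin_change (shear t) f)@_m = 0.
    by rewrite mulf_eq0 (negPf dlt) (negPf (lead_mon_supp lf)).
  have Qa (a : 'I_(size ps)) : dl.[t] * ((shear_family ps`_a)@_m).[t] =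
      \sum_(b < size us) ((shear_family ps`_a)@_(nth (@bm0 n d) us b)).[t] * (y b 0).[t].
    have := congr1 (fun M : 'cV_(size ps) => (M a 0).[t]) Ey; rewrite !mxE hornerM => ->.
    by rewrite horner_sum; apply: eq_bigr => b _; rewrite !mxE hornerM.
  rewrite coef // mulr_sumr; under eq_bigr do rewrite mulrCA Qa mulr_sumr.
  rewrite exchange_big big1 //= => b _.
  under eq_bigr do rewrite mulrA.
  rewrite -mulr_suml; have [db mb] := usE b.
  by rewrite -coef // (lead_mon_gt lf mb) mul0r.
pose F := \sum_a x 0 a *: shear_family ps`_a.
have Fu u : mdeg u = d -> revlex_lt m u -> F@_u = 0.
  move=> du mu; have [b <-] := usP u du mu.
  have Bb : (x *m B) 0 b = 0 by rewrite xB mxE.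
  by rewrite -[RHS]Bb [RHS]mxE raddf_sum; apply: eq_bigr => a _; rewrite /= mcoeffZ [in RHS]mxE.
pose c := (x *m Q) 0 0.
have Fm : F@_m = c.
  by rewrite /c mxE raddf_sum; apply: eq_bigr => a _; rewrite /= mcoeffZ [in RHS]mxE.
(* Product rule: differentiating the shear contributes x_i dF/dx_j, and the remaining terms, with
   the coefficients [x] differentiated, come from [J]. *)
have dF : \sum_a (x 0 a)^`() *: shear_family ps`_a = deriv_t F - 'X_i * F^`M(j).
  apply/mpolyP=> u; rewrite mcoeffB deriv_t_coef !raddf_sum /=.
  rewrite mulr_sumr raddf_sum -sumrB; apply: eq_bigr => a _.
  rewrite !mcoeffZ derivM -deriv_t_coef deriv_shear_family.
  by rewrite /= mderivZ -scalerAr mcoeffZ addrK.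
have [t] := poly_nonroot ch0 (mulf_neq0 p0 xQ); rewrite hornerM mulf_eq0 negb_or => /andP[pt ct].
pose f := \sum_a (x 0 a)^`().[t] *: ps`_a.
have coef u : (lin_change (shear t) f)@_u = ((F@_u)^`() - ('X_i * F^`M(j))@_u).[t].
  rewrite -deriv_t_coef -mcoeffB -dF [X in X@_u = _]linear_sum !raddf_sum /= horner_sum.
  by apply: eq_bigr => a _; rewrite linearZ /= !mcoeffZ shear_coef hornerM.
apply/(Gt t pt); exists f.
  by apply: ideal_sum => // a _; apply: idealZ.
have mjU : (m - U_(j) + U_(j))%MM = m by rewrite submK // lep1mP -lt0n.
have dv0 : mdeg v0 = d.
  by rewrite /d -mjU /v0 !mdegD !mdeg1.
have v0m : revlex_lt m v0.
  apply/revlex_ltP; rewrite ?dv0 //; exists j; split.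
    by rewrite !mnmDE mnmBE !mnm1E eqxx -val_eqE /= ltn_eqF //; lia.
  move=> l jl; rewrite !mnmDE mnmBE !mnm1E -!val_eqE /= !ltn_eqF //; last by lia.
  by rewrite subn0 addn0.
apply: lead_monP.
(* [F] has no term at [v0], which is above [m], so the coefficient is -m_j c(t), nonzero by the
   choice of t and characteristic 0. *)
- rewrite coef (Fu v0) // deriv0 sub0r hornerN oppr_eq0 mcoeff_mulX.
  have -> : (0 < v0 i)%N by rewrite mnmDE mnm1E eqxx addn1.
  rewrite addmK mcoeff_deriv mjU Fm hornerMn -mulr_natr mulf_eq0 (negPf ct).
  by move/pcharf0P: ch0 => ->.
(* For [u] above [v0], the monomial u x_j / x_i lies above m, where [F] has no term. *)
- move=> u du vu; have mu := revlex_lt_trans v0m vu.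
  have dud : mdeg u = d by rewrite du dv0.
  rewrite coef (Fu u) // deriv0 sub0r.
  rewrite mcoeff_mulX; case: ifP => ui; last by rewrite oppr0 horner0.
  have uU : (u - U_(i) + U_(i))%MM = u by rewrite submK // lep1mP -lt0n.
  rewrite mcoeff_deriv Fu ?mul0rn ?oppr0 ?horner0 //.
    by rewrite -dv0 -du -[in RHS]uU !mdegD !mdeg1.
  rewrite -(revlex_lt_add2r U_(i)) -addmA [(U_(j) + _)%MM]addmC addmA uU.
  by rewrite -mjU -addmA [(U_(j) + _)%MM]addmC addmA revlex_lt_add2r.
- by rewrite dv0; apply: lin_change_homog; apply: rpred_sum => a _; apply: rpredZ; apply: hps.
Qed.

End Shear.

(** * Generic coordinates *)

Lemma mmap_eval (k R : comNzRingType) (iota : {rmorphism k -> R}) (phi : {rmorphism R -> k})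
    N (P : {mpoly k[N]}) (v : 'I_N -> R) :
  cancel iota phi -> phi (mmap iota v P) = P.@[fun l => phi (v l)].
Proof.
move=> can; rewrite mevalE /mmap rmorph_sum; apply: eq_bigr => m _.
rewrite rmorphM can rmorph_prod; congr (_ * _).
by apply: eq_bigr => l _; rewrite rmorphXn.
Qed.

(** Uniqueness of base b digits: reduction modulo b gives the first digit, division by b the
    others. *)
Lemma digits_inj b n (u v : nat -> nat) :
  (forall l, (l < n)%N -> (u l < b)%N) -> (forall l, (l < n)%N -> (v l < b)%N) ->
  (\sum_(l < n) u l * b ^ l = \sum_(l < n) v l * b ^ l)%N -> forall l, (l < n)%N -> u l = v l.
Proof.
elim: n u v => // n IH u v hu hv; rewrite !big_ord_recl !expn0 !muln1 /=.
have tail (w : nat -> nat) : (\sum_(l < n) w (bump 0 l) * b ^ bump 0 l =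
    (\sum_(l < n) w l.+1 * b ^ l) * b)%N.
  by rewrite big_distrl; apply: eq_bigr => l _; rewrite /bump /= add1n expnSr mulnA.
rewrite !tail => e; have b0 : (0 < b)%N by apply: leq_ltn_trans (hu 0%N _).
have := congr1 (modn^~ b) e; rewrite /= ![(_ + _ * b)%N]addnC !modnMDl !modn_small ?hu ?hv // => e0.
move: e; rewrite e0 => /addnI/eqP; rewrite eqn_pmul2r // => /eqP e [|l] // ln.
by apply: (IH (fun l => u l.+1) (fun l => v l.+1)) => // l' ?; [apply: hu | apply: hv].
Qed.

(* Kronecker substitution [x_l := t ^ (b ^ l)] reduces this to one variable. *)
Lemma mpoly_nonroot (k : fieldType) n (P : {mpoly k[n]}) :
  [pchar k] =i pred0 -> P != 0 -> exists v, P.@[v] != 0.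
Proof.
(* [msize P] exceeds every degree in the support, so all exponents are base b digits. *)
move=> ch0 P0; pose b := msize P.
have [m mP] : exists m, m \in msupp P.
  by case: (msupp P) (msupp_eq0 P) => [|m s _]; [rewrite (negPf P0) | exists m; rewrite inE eqxx].
pose code (u : 'X_{1..n}) := (\sum_(l < n) u l * b ^ l)%N.
pose Q : {poly k} := \sum_(u <- msupp P) P@_u *: 'X^(code u).
have small u (l : 'I_n) : u \in msupp P -> (u l < b)%N.
  move=> /msize_mdeg_lt; apply: leq_ltn_trans.
  by rewrite mdegE (bigD1 l) //= leq_addr.
have code_inj u : u \in msupp P -> code u = code m -> u = m.
  move=> uP e; apply/mnmP=> l; rewrite !(mnm_nth 0).
  apply: (@digits_inj b n (nth 0%N u) (nth 0%N m)) => // [l' ln|l' ln|].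
  - by have := small _ (Ordinal ln) uP; rewrite (mnm_nth 0).
  - by have := small _ (Ordinal ln) mP; rewrite (mnm_nth 0).
  by move: e; rewrite /code; under eq_bigr do rewrite (mnm_nth 0); under [in RHS]eq_bigr do rewrite (mnm_nth 0).
have Qm : Q`_(code m) = P@_m.
  rewrite coef_sum (bigD1_seq m) ?msupp_uniq //= coefZ coefXn eqxx mulr1.
  rewrite big_seq_cond big1 ?addr0 // => u /andP[uP um].
  rewrite coefZ coefXn; case: eqP => [e'|_]; last by rewrite mulr0.
  by move: um; rewrite (code_inj u uP (esym e')) eqxx.
have Q0 : Q != 0.
  by apply: contraTneq mP => Q0; rewrite mcoeff_msupp negbK -Qm Q0 coef0.
have [t Qt] := poly_nonroot ch0 Q0; exists (fun l : 'I_n => t ^+ (b ^ l)).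
rewrite mevalE; move: Qt; rewrite /Q horner_sum; congr (_ != 0).
apply: eq_bigr => u _; rewrite hornerZ hornerXn /code expr_sum; congr (_ * _).
by apply: eq_bigr => l _; rewrite -exprM mulnC.
Qed.

Section Frames.
Variables (k : fieldType) (n : nat) (I : {mpoly k[n]} -> Prop) (G : pred 'X_{1..n}).
Hypotheses (ch0 : [pchar k] =i pred0) (homI : homogeneous_ideal I).
Variable P : {mpoly k[n * n]}.
Hypothesis ginP : forall g : 'M[k]_n, P.@[fun l => mxvec g 0 l] != 0 ->
  g \in unitmx /\ forall m, G m <-> init_ideal_change I g m.
Local Notation poly := {mpoly k[n]}.
Implicit Types (h g : 'M[k]_n) (q : 'I_n) (f : poly).

Definition mx_point r (v : 'I_(r * n) -> k) : 'M[k]_(r, n) := vec_mx (\row_l v l).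

Lemma mx_pointK r (Q : {mpoly k[r * n]}) v : Q.@[fun l => mxvec (mx_point v) 0 l] = Q.@[v].
Proof. by apply: meval_eq => l; rewrite vec_mxK mxE. Qed.

Let homJ g := ideal_image_homogeneous g homI.

Lemma gin_image g : P.@[fun l => mxvec g 0 l] != 0 ->
  forall m, G m <-> exists2 f, ideal_image g I f & lead_mon f m.
Proof.
move=> /ginP[ug Gg] m; split; first by move/Gg/(init_ideal_changeE _ _ ug).
by move/(init_ideal_changeE _ _ ug)/Gg.
Qed.

(** Starting from a matrix [g] with P(g) nonzero, P along g times the shear is a polynomial in t
    that does not vanish at 0, so [shear_stable] applies to the image of [I] under [g]. *)
Lemma gin_strongly_stable : P != 0 -> strongly_stable G.
Proof.
move=> P0 i j m ij mj Gm; have [v Pv] := mpoly_nonroot ch0 P0.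
pose g := mx_point v; have Pg : P.@[fun l => mxvec g 0 l] != 0 by rewrite mx_pointK.
have [ug _] := ginP Pg.
pose H : 'M[{poly k}]_n := map_mx polyC g *m (1%:M + 'X *: delta_mx j i).
pose p := mmap polyC (fun l => mxvec H 0 l) P.
have pE t : p.[t] = P.@[fun l => mxvec (g *m shear i j t) 0 l].
  rewrite -/(horner_eval t p) (@mmap_eval k {poly k} polyC (horner_eval t)) //; last first.
    by move=> c; apply: hornerC.
  apply: meval_eq => l /=; transitivity (mxvec (map_mx (horner_eval t) H) 0 l).
    by rewrite -map_mxvec [RHS]mxE.
  rewrite map_mxM map_mx_hornerC; congr (mxvec (_ *m _) 0 l).
  by apply/matrixP=> a b; rewrite !mxE /= /horner_eval hornerD hornerM hornerX -!polyC_natr !hornerC.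
apply: (@shear_stable _ _ i j ij (ideal_image g I) G p) => //.
  apply: contraTneq Pg => p0; rewrite negbK; have := pE 0; rewrite p0 horner0 => ->.
  by rewrite /shear scale0r addr0 mulmx1.
move=> t; rewrite pE => /ginP[ugt Gt] u; split=> [/Gt[f [If lf]]|[f If lf]].
  by exists (lin_change g f); rewrite ?lin_change_comp // /ideal_image lin_changeK.
by apply/Gt; exists (lin_change (invmx g) f); split=> //; rewrite -lin_change_comp lin_changeVK.
Qed.

Definition row_form h (l : 'I_n) : poly := \sum_a h l a *: 'X_a.

(** * Coordinates turning prescribed linear forms into variables *)

Section Frame.
Variables (h : 'M[k]_n) (lam : k).
(** The adjugate replaces the inverse so that [g] is polynomial in the entries of [h], and P(g)
    nonzero becomes an open condition on [h]. The scalar [lam] lets [g] be an exact inverse where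
    needed. *)
Let g := lam *: \adj h.
Let mu := lam * \det h.
Hypotheses (mu0 : mu != 0) (Pg : P.@[fun l => mxvec g 0 l] != 0).
Local Notation W := (lin_change g).
Local Notation W' := (lin_change (invmx g)).

Let ug : g \in unitmx. Proof. by case: (ginP Pg). Qed.
Let idI : is_ideal I. Proof. by case: homI. Qed.

Lemma row_form_image l : W (row_form h l) = mu *: 'X_l.
Proof.
rewrite linear_sum /=; under eq_bigr do rewrite linearZ /= lin_changeX scaler_sumr.
rewrite exchange_big /=; under eq_bigr => b _.
  under eq_bigr do rewrite scalerA.
  rewrite -scaler_suml; have -> : \sum_a h l a * g a b = (h *m g) l b by rewrite mxE.
  rewrite -scalemxAr mul_mx_adj !mxE mulrnAr -/mu; over.
rewrite (bigD1 l) //= eqxx big1 ?addr0 // => b bl.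
by rewrite eq_sym (negPf bl) scale0r.
Qed.

Variables (q : 'I_n) (Ls : seq poly).
Hypothesis LsP : forall x, x \in Ls <-> exists2 l : 'I_n, (q < l)%N & x = row_form h l.
Local Notation K := (ideal_add_forms I Ls).
Local Notation TK := (truncated_ideal (ideal_image g I) q).

(** [W] sends the rows of [h] after the q-th to nonzero multiples of the variables after x_q, so it
    carries [K] to the image of [I] plus these variables. *)
Lemma frame_ideal f : K f <-> TK (W f).
Proof.
have idK := ideal_add_forms_ideal Ls idI.
split=> [[f0 [fs [If0 ->]]]|[j Jj fj]].
  exists (W f0); first by rewrite /ideal_image lin_changeK.
  move=> u hu; rewrite linearD mcoeffD /= -[RHS]addr0; congr (_ + _).
  rewrite (linear_sum W) raddf_sum big1 //= => a _.
  have /LsP[l ql ->] : Ls`_a \in Ls by apply: mem_nth.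
  rewrite rmorphM /= row_form_image -scalerAr mcoeffZ [_ * 'X_l]mulrC mcoeff_mulX.
  by rewrite hu // mulr0.
have KL (l : 'I_n) : (q < l)%N -> K (row_form h l).
  move=> ql; have xL : row_form h l \in Ls by apply/LsP; exists l.
  have xl := xL; rewrite -index_mem in xl.
  exists 0, (fun a => (a == Ordinal xl)%:R); split; first exact: ideal0.
  rewrite add0r (bigD1 (Ordinal xl)) //= eqxx mul1r nth_index // big1 ?addr0 // => a na.
  by rewrite (negPf na) mul0r.
have KX (l : 'I_n) : (q < l)%N -> K (W' 'X_l).
  move=> ql; have -> : W' 'X_l = mu^-1 *: row_form h l.
    by rewrite -[row_form h l](lin_changeK ug) row_form_image linearZ /= scalerA mulVf // scale1r.
  by apply: idealZ => //; apply: KL.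
rewrite -[f](lin_changeK ug) -[W f](subrK j) addrC linearD; apply: idealD => //.
  exists (W' j), (fun=> 0); split=> //; rewrite big1 ?addr0 // => a _; exact: mul0r.
(* [W f] and [j] agree on monomials in x_0, ..., x_q, so each term of the difference is divisible by
   a later variable. *)
rewrite (mpolyE (W f - j)) (linear_sum W'); rewrite big_seq; apply: ideal_sum => // m.
rewrite mcoeff_msupp mcoeffB => nm; rewrite linearZ /=; apply: idealZ => //.
have [l ql ml] : exists2 l : 'I_n, (q < l)%N & (0 < m l)%N.
  apply: NNPP => nex; case/negP: nm; rewrite fj ?subrr // => l ql.
  by apply/eqP; rewrite -leqn0 leqNgt; apply/negP=> ml; apply: nex; exists l.
have -> : m = (m - U_(l) + U_(l))%MM by rewrite submK // lep1mP -lt0n.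
by rewrite mpolyXD rmorphM; apply: idealMl => //; apply: KX.
Qed.

Local Notation L := (row_form h q).

Lemma frame_mul i f : W (L ^+ i * f) = mu ^+ i *: ('X_q ^+ i * W f).
Proof. by rewrite rmorphM rmorphXn /= row_form_image exprZn -scalerAl. Qed.

Lemma frame_injective d i :
  (forall f, f \is d.-homog -> K (L ^+ i * f) -> K f) <->
  (forall u, vars_lt q.+1 u -> mdeg u = d -> G (u + U_(q) *+ i)%MM -> G u).
Proof.
rewrite -(truncated_injP (homJ g) (gin_image Pg)).
have tZ c f : c != 0 -> TK (c *: f) -> TK f.
  by move=> c0 tf; rewrite -[f]scale1r -(mulVf c0) -scalerA; apply: (truncated_idealZ (homJ g)).
split=> inj f hf.
  rewrite -[f](lin_changeVK ug) => tf; apply/frame_ideal; apply: inj.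
    exact: lin_change_homog.
  by apply/frame_ideal; rewrite frame_mul; apply: (truncated_idealZ (homJ g)).
move/frame_ideal; rewrite frame_mul => /tZ tf; apply/frame_ideal; apply: inj.
  exact: lin_change_homog.
by apply: tf; rewrite expf_neq0.
Qed.

Lemma frame_surjective d i :
  (forall f, f \is (d + i)%N.-homog -> exists f', f' \is d.-homog /\ K (f - L ^+ i * f')) <->
  (forall v, vars_lt q.+1 v -> mdeg v = (d + i)%N -> (v q < i)%N -> G v).
Proof.
rewrite -(truncated_surjP (homJ g) (gin_image Pg)); split=> surj f hf.
  have [f' [hf' /frame_ideal]] := surj (W' f) (lin_change_homog _ hf).
  rewrite linearB /= frame_mul lin_changeVK // => tf; exists (mu ^+ i *: W f'); split.
    by rewrite rpredZ // lin_change_homog.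
  by rewrite -scalerAr.
have [f' [hf' tf]] := surj (W f) (lin_change_homog _ hf).
exists (mu ^- i *: W' f'); split; first by rewrite rpredZ // lin_change_homog.
have WW' : W (mu ^- i *: W' f') = mu ^- i *: f' by rewrite linearZ /= lin_changeVK.
apply/frame_ideal; rewrite linearB /= frame_mul WW'.
by rewrite -scalerAr scalerA mulfV ?expf_neq0 // scale1r.
Qed.

End Frame.
End Frames.

(** * Polynomial conditions defining generic frames *)

Section GenericFrames.
Variables (k : fieldType) (n : nat) (P : {mpoly k[n * n]}).
Local Notation poly := {mpoly k[n]}.

(** Both conditions on a frame as a single product. The ring [R] is arbitrary so that [H] may
    contain indeterminates: the coefficients of the generic forms in [generic_frame], the parameter
    t in [generic_slp_gin]. *)
Definition frame_disc (R : comNzRingType) (iota : {rmorphism k -> R}) (lam : k) (H : 'M[R]_n) : R :=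
  mmap iota (fun l => mxvec (iota lam *: \adj H) 0 l) P * \det H.

Lemma frame_discE (R : comNzRingType) (iota : {rmorphism k -> R}) (phi : {rmorphism R -> k}) lam H :
  cancel iota phi -> phi (frame_disc iota lam H) =
    P.@[fun l => mxvec (lam *: \adj (map_mx phi H)) 0 l] * \det (map_mx phi H).
Proof.
move=> can; rewrite rmorphM /= -det_map_mx (mmap_eval _ _ can); congr (_ * _).
apply: meval_eq => l; rewrite -[in RHS](can lam) -map_mx_adj -map_mxZ -map_mxvec.
by rewrite [RHS]mxE.
Qed.

(** Take for h the inverse of a matrix in the open set and lam = 1 / det h; then lam adj(h) is that
    matrix again. *)
Lemma exists_frame : [pchar k] =i pred0 -> P != 0 ->
  (forall g : 'M[k]_n, P.@[fun l => mxvec g 0 l] != 0 -> g \in unitmx) ->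
  exists h lam, [/\ lam != 0, \det h != 0 & P.@[fun l => mxvec (lam *: \adj h) 0 l] != 0].
Proof.
move=> ch0 P0 unitP; have [v Pv] := mpoly_nonroot ch0 P0.
have Pg : P.@[fun l => mxvec (mx_point v) 0 l] != 0 by rewrite mx_pointK.
have ug := unitP _ Pg; pose h := invmx (mx_point v).
have uh : h \in unitmx by rewrite unitmx_inv.
have dh : \det h != 0 by rewrite -unitfE -unitmxE.
exists h, (\det h)^-1; rewrite invr_eq0; split=> //.
suff -> : (\det h)^-1 *: \adj h = mx_point v by [].
by rewrite -[RHS]invmxK -/h [RHS]/invmx uh.
Qed.

(* The rows of [c] go, in reverse order, to the last rows of [h]. *)
Definition replace_rows (R : nzRingType) r (c : 'M[R]_(r, n)) (h : 'M[R]_n) : 'M[R]_n :=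
  \matrix_(l, a) if (insub (rev_ord l : nat) : option 'I_r) is Some j then c j a else h l a.

Lemma map_replace_rows (R S : nzRingType) (phi : R -> S) r (c : 'M[R]_(r, n)) h :
  map_mx phi (replace_rows c h) = replace_rows (map_mx phi c) (map_mx phi h).
Proof. by apply/matrixP=> l a; rewrite !mxE; case: insub => [j|]; rewrite ?mxE. Qed.

Lemma replace_rows_same r (h : 'M[k]_n) : (r <= n)%N ->
  exists c : 'M[k]_(r, n), replace_rows c h = h.
Proof.
move=> rn; exists (\matrix_(j, a) h (rev_ord (widen_ord rn j)) a).
apply/matrixP=> l a; rewrite mxE; case: insubP => //= j _ ej.
rewrite mxE; congr (h _ a); apply: rev_ord_inj; apply: val_inj.
by rewrite rev_ordK /= ej.
Qed.

(** [rev_ord l] is n - l - 1, which is below n - q - 1 exactly for l > q, so the replaced rows are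
    those after the q-th. *)
Lemma lin_forms_replace_rows (q : 'I_n) (c : 'M[k]_(n - q.+1, n)) (h : 'M[k]_n) x :
  x \in lin_forms c <-> exists2 l : 'I_n, (q < l)%N & x = row_form (replace_rows c h) l.
Proof.
have rowE (l : 'I_n) (j : 'I_(n - q.+1)) : rev_ord l = j :> nat ->
    row_form (replace_rows c h) l = \sum_a c j a *: 'X_a.
  move=> e; apply: eq_bigr => a _; rewrite mxE; case: insubP => [j' _ ej'|].
    by congr (c _ a *: _); apply: val_inj; rewrite /= ej' e.
  by rewrite e ltn_ord.
split=> [/mapP[j _ ->]|[l ql ->]].
  have jn : (j < n)%N by apply: leq_trans (ltn_ord j) (leq_subr _ _).
  exists (rev_ord (Ordinal jn)); last by rewrite (rowE _ j) // rev_ordK.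
  by have := ltn_ord j; have := ltn_ord q; rewrite /=; lia.
have lj : (rev_ord l < n - q.+1)%N by have := ltn_ord l; rewrite /=; lia.
by rewrite (rowE l (Ordinal lj)) //; apply: map_f; rewrite mem_enum.
Qed.

(** [Q] is [frame_disc] with indeterminates in the last r rows; it is nonzero because putting back
    the rows of [h] gives a nonzero value. *)
Lemma generic_frame r (h : 'M[k]_n) lam : (r <= n)%N -> \det h != 0 ->
  P.@[fun l => mxvec (lam *: \adj h) 0 l] != 0 ->
  exists2 Q : {mpoly k[r * n]}, Q != 0 & forall c : 'M[k]_(r, n), Q.@[fun l => mxvec c 0 l] != 0 ->
    \det (replace_rows c h) != 0 /\ P.@[fun l => mxvec (lam *: \adj (replace_rows c h)) 0 l] != 0.
Proof.
move=> rn dh Ph; pose C : 'M[{mpoly k[r * n]}]_(r, n) := \matrix_(j, a) 'X_(mxvec_index j a).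
pose Q := frame_disc (@mpolyC (r * n) k) lam (replace_rows C (map_mx (@mpolyC (r * n) k) h)).
have QE (c : 'M[k]_(r, n)) : Q.@[fun l => mxvec c 0 l] =
    P.@[fun l => mxvec (lam *: \adj (replace_rows c h)) 0 l] * \det (replace_rows c h).
  rewrite /Q (frame_discE (phi := meval (fun l => mxvec c 0 l))); last by move=> a; apply: mevalC.
  rewrite map_replace_rows; set C' := map_mx _ C; set h' := map_mx _ (map_mx _ h).
  have -> : C' = c by apply/matrixP=> j a; rewrite !mxE /= mevalXU mxvecE.
  by have -> : h' = h by apply/matrixP=> j a; rewrite !mxE /= mevalC.
exists Q; last by move=> c; rewrite QE mulf_eq0 negb_or => /andP[].
have [c ec] := replace_rows_same h rn.
apply: contraNneq (mulf_neq0 Ph dh) => Q0.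
by rewrite -{1 2}ec -QE Q0 meval0.
Qed.

End GenericFrames.

(** * Generic Lefschetz properties and the generic initial ideal *)

Section Main.
Variables (k : fieldType) (n : nat) (I : {mpoly k[n]} -> Prop) (G : pred 'X_{1..n}).
Hypotheses (ch0 : [pchar k] =i pred0) (homI : homogeneous_ideal I) (ginG : is_gin I G).

(** The i generic forms fill the last i rows of a frame, and the row just before them, of index q =
    n - i - 1 >= 2, is the Lefschetz element for all degrees at once. *)
Lemma gin_generic_slp (i : nat) : (i + 3 <= n)%N ->
  (forall q : 'I_n, (2 <= q)%N -> forall d e, monomial_slp G q d e) ->
  generically (fun c : 'M[k]_(i, n) => SLP (ideal_add_forms I (lin_forms c))).
Proof.
move=> i3 slpG; have [P [P0 ginP]] := ginG.
have [h [lam [lam0 dh Ph]]] := exists_frame ch0 P0 (fun g Pg => (ginP g Pg).1).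
have qn : (n - i.+1 < n)%N by lia.
pose q := Ordinal qn; have ei : i = (n - q.+1)%N by rewrite /=; lia.
have q2 : (2 <= q)%N by rewrite /=; lia.
clearbody q; subst i; have [Q Q0 QP] := generic_frame (leq_subr q.+1 n) dh Ph.
exists Q; split=> // c /QP[dc Pc]; have mu0 := mulf_neq0 lam0 dc.
have LsP := lin_forms_replace_rows c h.
exists (row_form (replace_rows c h) q); split=> [|d e]; first exact: linear_form_homog.
have [inj|surj] := slpG q q2 d e.
  by left; apply/(frame_injective homI ginP mu0 Pc LsP).
by right; apply/(frame_surjective homI ginP mu0 Pc LsP).
Qed.

Lemma linear_form_coef (L : {mpoly k[n]}) : L \is 1.-homog -> L = \sum_a L@_U_(a) *: 'X_a.
Proof.
move=> hL; apply/mpolyP=> m; rewrite raddf_sum /=.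
have [/eqP/mdeg1P[b /eqP->]|nm] := eqVneq (mdeg m) 1%N.
  rewrite (bigD1 b) //= mcoeffZ mcoeffX eqxx mulr1 big1 ?addr0 // => a ab.
  by rewrite mcoeffZ mcoeffX eq_mnm1 (negPf ab) mulr0.
rewrite (dhomog_nemf_coeff hL nm) big1 // => a _; rewrite mcoeffZ mcoeffX.
by case: eqP => [e|_]; [rewrite -e mdeg1 in nm | rewrite mulr0].
Qed.

(** The Lefschetz element [L] need not complete [c] to a frame in the open set, so it is moved along
    a line: full rank at t = 0 and an admissible frame at t = 1 are open conditions, hence hold
    together for some t. *)
Lemma generic_slp_gin (q : 'I_n) d e : (2 <= q)%N ->
  generically (fun c : 'M[k]_(n - q.+1, n) => SLP (ideal_add_forms I (lin_forms c))) ->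
  monomial_slp G q d e.
Proof.
move=> q2 [P' [P'0 slpP']]; have [P [P0 ginP]] := ginG.
have [h0 [lam [lam0 dh0 Ph0]]] := exists_frame ch0 P0 (fun g Pg => (ginP g Pg).1).
have [Q Q0 QP] := generic_frame (leq_subr q.+1 n) dh0 Ph0.
have [v] := mpoly_nonroot ch0 (mulf_neq0 P'0 Q0); rewrite mevalM mulf_eq0 negb_or => /andP[P'v Qv].
pose c := mx_point v; have [|L [hL slpL]] := slpP' c; first by rewrite mx_pointK.
have [|dc Pc] := QP c; first by rewrite mx_pointK.
set h1 := replace_rows c h0 in dc Pc.
(* L + tD is [L] at t = 0 and row q of the frame [h1] at t = 1. *)
pose D := row_form h1 q - L.
have hD : D \is 1.-homog by rewrite rpredB // linear_form_homog.
pose rowH (t : k) (a : 'I_n) := L@_U_(a) + t * (h1 q a - L@_U_(a)).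
pose ht t : 'M[k]_n := \matrix_(l, a) if l == q then rowH t a else h1 l a.
pose H : 'M[{poly k}]_n := \matrix_(l, a) if l == q then
  (L@_U_(a))%:P + 'X * (h1 q a - L@_U_(a))%:P else (h1 l a)%:P.
have Ht t : map_mx (horner_eval t) H = ht t.
  apply/matrixP=> l a; rewrite [LHS]mxE [RHS]mxE [H l a]mxE /= /horner_eval; case: eqP => _; last by rewrite hornerC.
by rewrite hornerD hornerM hornerX !hornerC.
have rowq t : row_form (ht t) q = L + t *: D.
  rewrite /D [in RHS](linear_form_coef hL) -sumrB scaler_sumr -big_split.
  by apply: eq_bigr => a _; rewrite mxE eqxx /rowH scalerDl -scalerA scalerBl.
have LsP t x : x \in lin_forms c <-> exists2 l : 'I_n, (q < l)%N & x = row_form (ht t) l.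
  rewrite (lin_forms_replace_rows c h0) -/h1.
  have E (l : 'I_n) : (q < l)%N -> row_form (ht t) l = row_form h1 l.
    by move=> ql; apply: eq_bigr => a _; rewrite mxE -val_eqE /= gtn_eqF.
  by split=> [[l ql ->]|[l ql ->]]; exists l; rewrite ?E.
pose F := frame_disc P (@polyC k) lam H.
have FE t : F.[t] = P.@[fun l => mxvec (lam *: \adj (ht t)) 0 l] * \det (ht t).
  by rewrite -/(horner_eval t F) (@frame_discE k n P {poly k} polyC (horner_eval t)) ?Ht // => a; apply: hornerC.
have F0 : F != 0.
  have h11 : ht 1 = h1.
    by apply/matrixP=> l a; rewrite mxE; case: eqP => [->|//]; rewrite /rowH mul1r addrC subrK.
  apply: contraNneq (mulf_neq0 Pc dc) => F0.
  by rewrite -h11 -FE F0 horner0.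
have idI : is_ideal I by case: homI.
have idK := ideal_add_forms_ideal (lin_forms c) idI.
case: (slpL d e) => [/(injective_generic idK hL hD)|/(surjective_generic idK hL hD)] [p p0 pP].
  have [t] := poly_nonroot ch0 (mulf_neq0 p0 F0); rewrite hornerM mulf_eq0 negb_or FE mulf_eq0 negb_or.
  move=> /and3P[pt Pt dt]; left; have mu0 := mulf_neq0 lam0 dt.
  by apply/(frame_injective homI ginP mu0 Pt (LsP t)); rewrite rowq; apply: pP.
have [t] := poly_nonroot ch0 (mulf_neq0 p0 F0); rewrite hornerM mulf_eq0 negb_or FE mulf_eq0 negb_or.
move=> /and3P[pt Pt dt]; right; have mu0 := mulf_neq0 lam0 dt.
by apply/(frame_surjective homI ginP mu0 Pt (LsP t)); rewrite rowq; apply: pP.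
Qed.

Lemma gin_upset : upset G.
Proof.
have [P [P0 ginP]] := ginG; have [v Pv] := mpoly_nonroot ch0 P0.
have Pg : P.@[fun l => mxvec (mx_point v) 0 l] != 0 by rewrite mx_pointK.
exact: initial_ideal_upset (ideal_image_homogeneous _ homI) (gin_image ginP Pg).
Qed.

End Main.

Theorem theorem2p7 (k : fieldType) (n : nat)
    (I : {mpoly k[n]} -> Prop) (G : pred 'X_{1..n}) :
  [pchar k] =i pred0 ->
  homogeneous_ideal I ->
  artinian I ->
  is_gin I G ->
  almost_revlex G <->
  ((forall i : nat, (i + 3 <= n)%N ->
      generically (fun c : 'M[k]_(i, n) => SLP (ideal_add_forms I (lin_forms c))))
   /\
   (forall i : nat, (3 <= i)%N -> (i < n)%N ->
      forall a b : seq nat, inJ G i a -> inJ G i b ->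
        sumn a = sumn b -> revlex_lt (xmon n a) (xmon n b) ->
        ole (fexp G b) (fexp G a))).
Proof.
move=> ch0 homI _ ginG; have upG := gin_upset ch0 homI ginG.
split=> [arG|[slp ninc]].
  split=> [i i3|i i3 iltn]; last by apply: almost_revlex_nonincreasing => //; apply: leq_trans i3.
  apply: (gin_generic_slp ch0 homI ginG i3) => q _ d e.
  exact: almost_revlex_monomial_slp.
have stG : strongly_stable G.
  by have [P [P0 ginP]] := ginG; apply: gin_strongly_stable homI P ginP P0.
apply: monomial_slp_almost_revlex => // q q2 d e.
(* Condition (1) is used with i = n - q - 1; then q >= 2 means i <= n - 3. *)
apply: (generic_slp_gin ch0 homI ginG) => //; apply: slp.
by have := ltn_ord q; lia.
Qed.
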